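(* We have $E^C_{\mathrm{AC}([0,1])} \sim_B E^H_{\mathrm{AC}([0,1])}$.
   Context: $\mathcal{H}^+([0,1])$ is the group of increasing homeomorphisms of $[0,1]$ onto itself, with the supremum metric. $\mathrm{AC}([0,1]) = \{f \in \mathcal{H}^+([0,1]) : f \text{ and } f^{-1} \text{ are absolutely continuous}\}$, with the metric $d_{\mathrm{AC}}(f,g) = \sup_{t\in[0,1]}|f(t)-g(t)| + \int_0^1 |f'(t)-g'(t)|\,dt$; this makes it a Polish group whose Borel structure coincides with that generated by the supremum metric. $\mathcal{F}([0,1])$ is the space of closed subsets of $[0,1]$ with the Vietoris topology. $E^H_{\mathrm{AC}([0,1])}$ is the equivalence relation on $\mathcal{F}([0,1])$ given by: $F_1\, E^H_{\mathrm{AC}([0,1])}\, F_2$ iff there is $g \in \mathrm{AC}([0,1])$ with $g(F_1)=F_2$. $E^C_{\mathrm{AC}([0,1])}$ is the equivalence relation on $\mathrm{AC}([0,1])$ given by: $f_1\, E^C_{\mathrm{AC}([0,1])}\, f_2$ iff there is $g \in \mathrm{AC}([0,1])$ with $g \circ f_1\circ g^{-1} = f_2$. For equivalence relations $E, F$ on standard Borel spaces $X, Y$: $E \leq_B F$ means there is a Borel map $f: X \to Y$ with $x E y \iff f(x) F f(y)$ for all $x,y\in X$; $E \sim_B F$ means $E \leq_B F$ and $F \leq_B E$. *)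

(* Defs.v *)
From HB Require Import structures.
From mathcomp Require Import all_boot all_order all_algebra.
From mathcomp Require Import all_classical all_reals all_analysis.

Set Implicit Arguments.
Unset Strict Implicit.
Unset Printing Implicit Defensive.
Import Order.TTheory GRing.Theory Num.Theory.
Import numFieldNormedType.Exports.

Local Open Scope classical_set_scope.
Local Open Scope ring_scope.

Definition unit_interval (R : realType) : set R := `[0, 1]%classic.

(* Carries the subspace topology of R, as does every set coerced to a type. *)
Notation I01 R := (set_type (@unit_interval R)).

(* The inverse is a field, but it is determined by [homeo_fun]. *)
Record increasing_homeo (R : realType) := IncreasingHomeo {
  homeo_fun :> I01 R -> I01 R ;
  homeo_inv : I01 R -> I01 R ;
  homeo_funK : cancel homeo_fun homeo_inv ;
  homeo_invK : cancel homeo_inv homeo_fun ;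
  homeo_fun_continuous : continuous homeo_fun ;
  homeo_inv_continuous : continuous homeo_inv ;
  homeo_increasing :
    forall x y : I01 R, val x < val y -> val (homeo_fun x) < val (homeo_fun y)
}.

Definition absolutely_continuous (R : realType) (f : I01 R -> I01 R) : Prop :=
  forall e : R, 0 < e -> exists2 d : R, 0 < d &
    forall (n : nat) (a b : 'I_n -> I01 R),
      (forall i, val (a i) <= val (b i)) ->
      trivIset setT (fun i => `]val (a i), val (b i)[%classic) ->
      \sum_(i < n) (val (b i) - val (a i)) < d ->
      \sum_(i < n) `|val (f (b i)) - val (f (a i))| < e.

Record AC01 (R : realType) := MkAC01 {
  AC_homeo :> increasing_homeo R ;
  AC_fun : absolutely_continuous (homeo_fun AC_homeo) ;
  AC_inv : absolutely_continuous (homeo_inv AC_homeo)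
}.

(* Derivative of f on the open interval, where it does not depend on the value
   chosen off [0, 1].  At the endpoints, and where f is not differentiable
   (a null set when f is monotone), it is a junk value. *)
Definition unit_derive (R : realType) (f : I01 R -> I01 R) : R -> R :=
  derive1 ('valL_ 0 (fun t : I01 R => val (f t))).

Definition dAC (R : realType) (f g : AC01 R) : R :=
  sup (range (fun t : I01 R => `|val (f t) - val (g t)|)) +
  \int[lebesgue_measure]_(t in @unit_interval R)
     `|unit_derive f t - unit_derive g t|.

Section AC_topology.
Variable R : realType.

Lemma absolutely_continuous_id : absolutely_continuous (@id (I01 R)).
Proof.
move=> e e0; exists e => // n a b ab _ lt; apply: le_lt_trans lt.
by apply: ler_sum => i _; rewrite ger0_norm // subr_ge0.
Qed.

Definition increasing_homeo_id : increasing_homeo R :=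
  @IncreasingHomeo R id id (fun=> erefl) (fun=> erefl)
    (fun=> cvg_id) (fun=> cvg_id) (fun _ _ => id).

Definition AC_id : AC01 R :=
  @MkAC01 R increasing_homeo_id
    absolutely_continuous_id absolutely_continuous_id.

HB.instance Definition _ := gen_eqMixin (AC01 R).
HB.instance Definition _ := gen_choiceMixin (AC01 R).
HB.instance Definition _ := isPointed.Build (AC01 R) AC_id.

Definition dAC_open : set (set (AC01 R)) :=
  [set U | forall f, U f ->
     exists2 e : R, 0 < e & forall g, dAC f g < e -> U g].

Lemma dAC_openT : dAC_open setT.
Proof. by move=> f _; exists 1. Qed.

Lemma dAC_openI : setI_closed dAC_open.
Proof.
move=> U V oU oV f [/oU[e e0 eU] /oV[e' e'0 eV]].
exists (Num.min e e'); first by rewrite lt_min e0.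
by move=> g; rewrite lt_min => /andP[/eU ? /eV].
Qed.

Lemma dAC_open_bigcup (J : Type) (U : J -> set (AC01 R)) :
  (forall j, dAC_open (U j)) -> dAC_open (\bigcup_j U j).
Proof.
move=> oU f [j _ /oU[e e0 eU]]; exists e => // g /eU Ug.
by exists j.
Qed.

HB.instance Definition _ := isOpenTopological.Build (AC01 R)
  dAC_openT dAC_openI dAC_open_bigcup.

End AC_topology.

Record closed_subsets (X : topologicalType) := ClosedSubset {
  closed_set :> set X ;
  closed_setP : closed closed_set
}.

Section vietoris.
Variable X : topologicalType.

HB.instance Definition _ := gen_eqMixin (closed_subsets X).
HB.instance Definition _ := gen_choiceMixin (closed_subsets X).
HB.instance Definition _ :=
  isPointed.Build (closed_subsets X) (ClosedSubset closed0).

Definition vietoris_subbase : set (set (closed_subsets X)) :=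
  [set [set F : closed_subsets X | F `<=` U] | U in @open X] `|`
  [set [set F : closed_subsets X | F `&` U !=set0] | U in @open X].

HB.instance Definition _ :=
  isSubBaseTopological.Build (closed_subsets X) vietoris_subbase id.

End vietoris.

Definition borel (X : ptopologicalType) : measurableType _ :=
  g_sigma_algebraType (@open X).

Definition borel_reducible (X Y : ptopologicalType)
    (E : X -> X -> Prop) (F : Y -> Y -> Prop) : Prop :=
  exists2 f : X -> Y,
    measurable_fun setT (f : borel X -> borel Y) &
    forall x y, E x y <-> F (f x) (f y).

Definition borel_bireducible (X Y : ptopologicalType)
    (E : X -> X -> Prop) (F : Y -> Y -> Prop) : Prop :=
  borel_reducible E F /\ borel_reducible F E.

Definition E_H (R : realType) (F1 F2 : closed_subsets (I01 R)) : Prop :=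
  exists g : AC01 R, g @` F1 = F2.

Definition E_C (R : realType) (f1 f2 : AC01 R) : Prop :=
  exists g : AC01 R, forall x, g (f1 (homeo_inv g x)) = f2 x.

(* Main.v *)
(* The conjugacy class of f in AC([0,1]) is determined by the set Fix(f) and the
   sign of f(x) - x on each complementary interval, up to AC([0,1]): if g carries
   these data for f1 to those for f2, then on each complementary interval any
   affine map between fundamental domains extends equivariantly to a conjugacy,
   and these pieces together with g on Fix(f1) form an increasing homeomorphism.
   It is absolutely continuous because it agrees at every point with one of
   countably many maps sending null sets to null sets.

   To reduce conjugacy to closed sets, f is sent to Fix(f) together with a sequence
   of markers in each complementary interval converging to its left end: isolated
   points where f moves points up, isolated closed intervals where f moves points
   down. The points of Fix(f) are then exactly those which belong to no isolated
   point or interval, so both Fix(f) and the signs can be recovered.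

   Conversely, a closed set F is sent to x + sum_n c_n b_n(x), where the b_n are
   smooth bumps supported on rational intervals and the signs c_n are chosen so
   that the fixed points are a copy of F in [1/4, 3/4] together with intervals
   coding whether F contains 0 and 1. This map is Borel since it factors through
   the Cantor space of the codes (c_n), on which it is continuous. *)
Require Import Defs.
From HB Require Import structures.
From mathcomp Require Import all_boot all_order all_algebra.
From mathcomp Require Import all_classical all_reals all_analysis.
From mathcomp Require Import measurable_realfun ring lra zify.

Set Implicit Arguments.
Unset Strict Implicit.
Unset Printing Implicit Defensive.
Import Order.TTheory GRing.Theory Num.Theory.
Import numFieldNormedType.Exports.

Local Open Scope classical_set_scope.
Local Open Scope ring_scope.

(** * Lusin's condition (N) *)

(** The conjugacies are pasted from infinitely many pieces whose slopes have no common bound, so an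
    epsilon-delta estimate for the whole map cannot be assembled from estimates for the pieces.
    Condition (N) can: it concerns one null set at a time and survives countable decompositions. The
    constructions therefore work with (N) on the line, and epsilon-delta estimates occur only in the
    passage from and to AC([0,1]).

    In the direction from closed sets to conjugacy the obstacle is that the metric also sees
    derivatives: codes close to each other must give displacements whose derivatives are uniformly
    close, hence the C^1 bumps with bounds independent of the rational interval. The points 1/4 and
    3/4 are fixed whether or not F contains 0 and 1, which is why the ends of F need a record of
    their own. The two intervals moved down force every conjugacy to fix 1/4 and 3/4, so that it
    induces a map of [0,1]. *)

Definition lusin (R : realType) (h : R -> R) :=
  forall A : set R, lebesgue_measure.-negligible A ->
    lebesgue_measure.-negligible (h @` A).

Section lusin_theory.
Variable R : realType.
Local Notation lam := (@lebesgue_measure R).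
Implicit Types (h : R -> R) (A B : set R).

Lemma lebesgue_itv_oo (a b : R) : a <= b -> lam `]a, b[%classic = (b - a)%:E.
Proof.
move=> ab; rewrite lebesgue_measure_itv/= lte_fin; case: ltP => //.
by move=> ba; rewrite (le_anti (introT andP (conj ab ba))) subrr.
Qed.

Lemma lebesgue_itv_cc (a b : R) : a <= b -> lam `[a, b]%classic = (b - a)%:E.
Proof.
move=> ab; rewrite lebesgue_measure_itv/= lte_fin; case: ltP => //.
by move=> ba; rewrite (le_anti (introT andP (conj ab ba))) subrr.
Qed.

Lemma le_lebesgue A B : measurable A -> measurable B -> A `<=` B ->
  (lam A <= lam B)%E.
Proof. by move=> mA mB; apply: (@le_measure _ _ _ lam); rewrite inE. Qed.

Lemma negligible_subset A B : A `<=` B -> lam.-negligible B ->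
  lam.-negligible A.
Proof. by move=> AB [N [mN N0 BN]]; exists N; split=> //; exact: subset_trans BN. Qed.

Lemma negligible_outer A :
  (forall e : R, 0 < e -> exists2 B, measurable B /\ A `<=` B & (lam B <= e%:E)%E) ->
  lam.-negligible A.
Proof.
move=> H.
have H' n : exists B, [/\ measurable B, A `<=` B & (lam B <= (n.+1%:R^-1)%:E)%E].
  have [|B [mB AB] lB] := H n.+1%:R^-1; first by rewrite invr_gt0.
  by exists B.
have [B HB] := choice H'.
have mI : measurable (\bigcap_n B n).
  by apply: bigcapT_measurable => n; have [] := HB n.
exists (\bigcap_n B n); split => //; last first.
  by move=> x Ax n _; have [_ AB _] := HB n; exact: AB.
apply/eqP; rewrite eq_le measure_ge0 andbT.
apply/lee_addgt0Pr => e e0; rewrite add0e.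
have [n ne] : exists n, n.+1%:R^-1 < e.
  by exists (Num.trunc e^-1); rewrite invf_plt ?posrE// truncnS_gt.
have [mB AB lB] := HB n.
apply: (@le_trans _ _ (lam (B n))).
  by apply: le_lebesgue => // x; apply.
by apply: (le_trans lB); rewrite lee_fin ltW.
Qed.

Lemma negligible_open A (d : R) : lam.-negligible A -> 0 < d ->
  exists U, [/\ open U, A `<=` U & (lam U < d%:E)%E].
Proof.
move=> [N [mN N0 AN]] d0.
have lN : (lebesgue_measure N < +oo)%E.
  by rewrite (_ : lebesgue_measure N = 0%E)//; exact: N0.
have [U [oU NU lU]] := lebesgue_regularity_outer mN lN d0.
exists U; split=> //; first exact: subset_trans NU.
have mU : measurable U by exact: open_measurable.
apply: le_lt_trans lU; rewrite -[leRHS]add0e -[X in (X + _)%E]N0.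
have mUN : measurable (U `\` N) by exact: measurableD.
by have := measureU2 lam mN mUN; rewrite setDUK.
Qed.

Lemma bigsetU_subset (T : Type) n (F : 'I_n -> set T) (U : set T) :
  (forall i, F i `<=` U) -> \big[setU/set0]_(i < n) F i `<=` U.
Proof. by move=> FU; elim/big_ind: _ => // B C BU CU x [/BU|/CU]. Qed.

(* An open set is the inferior limit of the unions [V n] of the cells of the
   grid of mesh [(v - u) / (n + 1)] which it contains. *)
Lemma ac_lusin_itv h (u v : R) : u < v -> {homo h : x y / x <= y} ->
  (forall e : R, 0 < e -> exists2 d : R, 0 < d &
    forall (n : nat) (a b : 'I_n -> R),
      (forall i, [/\ u <= a i, a i <= b i & b i <= v]) ->
      trivIset setT (fun i => `]a i, b i[%classic) ->
      \sum_(i < n) (b i - a i) < d ->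
      \sum_(i < n) (h (b i) - h (a i)) < e) ->
  forall A, A `<=` `[u, v[%classic -> lam.-negligible A ->
    lam.-negligible (h @` A).
Proof.
move=> uv hh AC A Auv nA; apply: negligible_outer => e /AC[d d0 {}AC].
have [U [oU AU lU]] := negligible_open nA d0.
have vu0 : 0 < v - u by rewrite subr_gt0.
pose pt n i : R := u + (v - u) * (i%:R / n.+1%:R).
have pt_homo n i j : (i <= j)%N -> pt n i <= pt n j.
  move=> ij; rewrite lerD2l ler_pM2l// ler_pM2r ?ler_nat//.
pose sel n i := `[pt n i, pt n i.+1]%classic `<=` U.
(* A cell not contained in [U] is collapsed to its left end, so that all [n.+1] indices stay in the
   sum; its image in [V n] is a single point. *)
pose b n i : R := if `[< sel n i >] then pt n i.+1 else pt n i.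
pose V n : set R := \big[setU/set0]_(i < n.+1) `[h (pt n i), h (b n i)]%classic.
have ab n i : pt n i <= b n i.
  by rewrite /b; case: ifP => // _; exact: pt_homo.
have bS n i : b n i <= pt n i.+1.
  by rewrite /b; case: ifP => // _; exact: pt_homo.
have tI n : trivIset setT (fun i : 'I_n.+1 => `]pt n i, b n i[%classic).
  apply/trivIsetP => i j _ _ /=.
  wlog : i j / (i < j)%N.
    move=> W ij; have [|ji|/val_inj ji] := ltngtP i j.
    - by move=> /W; apply.
    - by rewrite setIC; apply: W => //; rewrite eq_sym.
    - by rewrite ji eqxx in ij.
  move=> ij _; apply/seteqP; split=> // x [/=]; rewrite !in_itv/= => /andP[_ xb] /andP[jx _].
  have := lt_le_trans xb (bS n i); move/lt_le_trans/(_ (pt_homo n _ _ ij)).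
  by move/(lt_trans jx); rewrite ltxx.
have lV n : (lam (V n) <= e%:E)%E.
  apply: (@le_trans _ _ (\sum_(i < n.+1) (h (b n i) - h (pt n i))%:E)%E).
    have mF i : (i < n.+1)%N -> measurable `[h (pt n i), h (b n i)]%classic by [].
    apply: le_trans (Boole_inequality lam mF) _.
    by apply: lee_sum => i _; rewrite /lam/= lebesgue_itv_cc// hh.
  rewrite sumEFin lee_fin ltW//; apply: AC => //.
    move=> i; split=> //.
      by rewrite lerDl mulr_ge0// ?ltW// divr_ge0.
    apply: (le_trans (bS n i)); rewrite -lerBrDl ger_pMr// ler_pdivrMr// mul1r ler_nat.
    exact: ltn_ord.
  rewrite -lte_fin -sumEFin.
  have -> : (\sum_(i < n.+1) (b n i - pt n i)%:E =
      lam (\big[setU/set0]_(i < n.+1) `]pt n i, b n i[%classic))%E.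
    rewrite measure_semi_additive_ord//.
    - by apply: eq_bigr => i _; rewrite /lam/= lebesgue_itv_oo.
    - by apply: bigsetU_measurable => i _; exact: measurable_itv.
  apply: le_lt_trans lU; apply: le_lebesgue.
  - by apply: bigsetU_measurable => i _; exact: measurable_itv.
  - exact: open_measurable.
  - apply: bigsetU_subset => i x /=; rewrite /b in_itv/=; case: asboolP => [s|_] /andP[x1 x2].
      by apply: s; rewrite /= in_itv/= !ltW.
    by have := lt_trans x1 x2; rewrite ltxx.
have mV n : measurable (V n) by apply: bigsetU_measurable => i _; exact: measurable_itv.
pose W m : set R := \bigcap_(n in [set n | (m <= n)%N]) V n.
have mW m : measurable (W m) by apply: bigcap_measurable => //; exists m => /=.
have mB : measurable (\bigcup_m W m) by exact: bigcupT_measurable.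
exists (\bigcup_m W m).
  split=> // y [x Ax <-].
  have /oU : U x by exact: AU.
  rewrite /interior -nbhs_ballE => -[r /= r0 rU].
  (* From this index on the mesh is below [r], so the cell containing [x] lies in the ball of radius
     [r] around [x], hence in [U]. *)
  exists (Num.trunc ((v - u) / r)) => //= n mn.
  have vr : (v - u) / n.+1%:R < r.
    rewrite ltr_pdivrMr// mulrC -ltr_pdivrMr//.
    by apply: lt_le_trans (truncnS_gt _) _; rewrite ler_nat ltnS.
  have := Auv _ Ax; rewrite /= in_itv/= => /andP[ux xv].
  pose z := (x - u) / (v - u) * n.+1%:R.
  have z0 : 0 <= z by rewrite mulr_ge0// divr_ge0// ?subr_ge0// ltW.
  have zn : (Num.trunc z < n.+1)%N.
    rewrite truncn_lt_nat// /z gtr_pMl// ltr_pdivrMr// mul1r ltrD2r//.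
  have /andP[z1 z2] := truncn_itv z0.
  have xE : x = u + (v - u) * (z / n.+1%:R).
    by rewrite /z mulfK// mulrC mulfVK ?gt_eqF// addrC subrK.
  have x1 : pt n (Num.trunc z) <= x.
    by rewrite [leRHS]xE lerD2l ler_pM2l// ler_pM2r.
  have x2 : x <= pt n (Num.trunc z).+1.
    by rewrite [leLHS]xE lerD2l ler_pM2l// ler_pM2r// ltW.
  have d12 : pt n (Num.trunc z).+1 - pt n (Num.trunc z) < r.
    apply: le_lt_trans vr; rewrite /pt -natr1 le_eqVlt; apply/orP; left; apply/eqP.
    by field; rewrite nat1r.
  have s : sel n (Num.trunc z).
    move=> t /=; rewrite in_itv/= => /andP[t1 t2]; apply: rU.
    rewrite /ball/= ltr_norml; apply/andP; split; lra.
  rewrite /V -(bigcup_mkord _ (fun i => `[h (pt n i), h (b n i)]%classic)).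
  exists (Num.trunc z) => //=.
  by rewrite in_itv/= hh//=; apply: hh; rewrite /b; case: asboolP.
(* The sets [W m] increase, and each has measure at most [e] because it is contained in [V m]. *)
have cvgB : lam (W m) @[m --> \oo] --> lam (\bigcup_m W m).
  apply: nondecreasing_cvg_mu => // m n mn; apply/subsetPset => x Wx k /= nk.
  by apply: Wx => /=; exact: leq_trans nk.
rewrite -(cvg_lim _ cvgB)//; apply: lime_le; first by apply/cvg_ex; eexists; exact: cvgB.
apply: nearW => m; apply: le_trans (lV m).
by apply: le_lebesgue => // x; apply => /=.
Qed.

End lusin_theory.

(** * Absolute continuity from condition (N), and closure properties of (N) *)

Section lusin_converse.
Variable R : realType.
Local Notation lam := (@lebesgue_measure R).
Implicit Types (h : R -> R) (A B : set R).

Lemma lebesgue_bigsetU_itv n (a b : 'I_n -> R) :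
  (forall i, a i <= b i) ->
  trivIset setT (fun i => `]a i, b i[%classic) ->
  lam (\big[setU/set0]_(i < n) `]a i, b i[%classic) =
    (\sum_(i < n) (b i - a i))%:E.
Proof.
move=> ab tI; rewrite measure_semi_additive_ord//.
- by rewrite -sumEFin; apply: eq_bigr => i _; rewrite /lam/= lebesgue_itv_oo.
- by apply: bigsetU_measurable => i _; exact: measurable_itv.
Qed.

Lemma image_itv_oo h hi (a b : R) : cancel h hi -> cancel hi h ->
  {mono h : x y / x <= y} -> h @` `]a, b[ = `]h a, h b[%classic.
Proof.
move=> hK hiK hm; apply/seteqP; split => [_ [x /= + <-]|y /=]; rewrite !in_itv/=.
  by rewrite !(leW_mono hm).
move=> ayb; exists (hi y); last exact: hiK.
by rewrite /= in_itv/= -(leW_mono hm a) -(leW_mono hm _ b) hiK.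
Qed.

Lemma image_bigsetU n (I J : Type) (F : 'I_n -> set I) (h : I -> J) :
  h @` (\big[setU/set0]_(i < n) F i) = \big[setU/set0]_(i < n) (h @` F i).
Proof.
elim/big_rec2 : _ => [|i y1 y2 _ <-]; first by rewrite image_set0.
by rewrite image_setU.
Qed.

(* Borel-Cantelli for sets [E k] of measure at most [2^-k-1] whose images have
   measure at least [e]. *)
Lemma lusin_ac h hi (u v : R) : u <= v -> cancel h hi -> cancel hi h ->
  {mono h : x y / x <= y} -> lusin h ->
  forall e : R, 0 < e -> exists2 d : R, 0 < d &
    forall (n : nat) (a b : 'I_n -> R),
      (forall i, [/\ u <= a i, a i <= b i & b i <= v]) ->
      trivIset setT (fun i => `]a i, b i[%classic) ->
      \sum_(i < n) (b i - a i) < d ->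
      \sum_(i < n) (h (b i) - h (a i)) < e.
Proof.
move=> uv hK hiK hmle lh e e0; apply: contrapT => H.
have inj : injective h by exact: can_inj hK.
have E0 (k : nat) : exists E : set R, [/\ measurable E, measurable (h @` E),
   h @` E `<=` `[h u, h v]%classic, (lam E <= (1 / (2 ^ k.+1)%:R)%:E)%E & (e%:E <= lam (h @` E))%E].
  apply: contrapT => Hk; apply: H; exists (1 / (2 ^ k.+1)%:R).
    by rewrite divr_gt0// ltr0n expn_gt0.
  move=> n a b uabv tI lt; rewrite ltNge; apply/negP => ge; apply: Hk.
  have hE : h @` (\big[setU/set0]_(i < n) `]a i, b i[%classic) =
      \big[setU/set0]_(i < n) `]h (a i), h (b i)[%classic.
    by rewrite image_bigsetU; apply: eq_bigr => i _; exact: image_itv_oo hK hiK hmle.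
  exists (\big[setU/set0]_(i < n) `]a i, b i[%classic); rewrite hE; split.
  - by apply: bigsetU_measurable => i _; exact: measurable_itv.
  - by apply: bigsetU_measurable => i _; exact: measurable_itv.
  - apply: bigsetU_subset => i x /=; rewrite !in_itv/= => /andP[x1 x2].
    have [u1 _ v1] := uabv i.
    by rewrite (ltW (le_lt_trans _ x1)) ?hmle//= (ltW (lt_le_trans x2 _)) ?hmle.
  - rewrite lebesgue_bigsetU_itv//; first by rewrite lee_fin ltW.
    by move=> i; have [] := uabv i.
  - rewrite lebesgue_bigsetU_itv ?lee_fin//.
      by move=> i; rewrite hmle; have [] := uabv i.
    move=> i j _ _ [y []]; rewrite -!(image_itv_oo _ _ hK hiK hmle) => -[x1 X1 <-] [x2 X2 /inj x12].
    by apply: tI => //; exists x1; split=> //; rewrite -x12.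
have [E HE] := choice E0.
have mE k : measurable (E k) by have [] := HE k.
have mhE k : measurable (h @` (E k)) by have [] := HE k.
have lim0 : lam (lim_sup_set E) = 0%E.
  apply: lim_sup_set_cvg0 => //.
  apply: (@le_lt_trans _ _ 1%:E); last exact: ltry.
  apply: le_trans (epsilon_trick0 xpredT ler01).
  by apply: lee_nneseries => // k *; have [] := HE k.
have mlim : measurable (lim_sup_set (fun k => h @` (E k))).
  apply: bigcap_measurable; first by exists 0%N.
  by move=> n _; apply: bigcup_measurable.
(* By injectivity the single preimage [hi y] lies in every [E k] whose image contains [y]. *)
have sub : lim_sup_set (fun k => h @` (E k)) `<=` h @` (lim_sup_set E).
  move=> y Hy; exists (hi y) => // n _.
  have [k nk [x Ex xy]] := Hy n I; exists k => //.
  by rewrite -xy hK.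
have nl : lam.-negligible (lim_sup_set (fun k => h @` (E k))).
  apply: negligible_subset sub _; apply: lh; apply/negligibleP => //.
  apply: bigcap_measurable; first by exists 0%N.
  by move=> n _; apply: bigcup_measurable => k _; exact: mE.
have l0 : lam (lim_sup_set (fun k => h @` (E k))) = 0%E by apply/negligibleP.
(* Continuity from above; the finite measure it requires comes from all the images lying in
   [[h u, h v]]. *)
have cv : lam (\bigcup_(k in [set k | (n <= k)%N]) (h @` E k)) @[n --> \oo]
    --> lam (lim_sup_set (fun k => h @` (E k))).
  apply: lim_sup_set_cvg => //.
  apply: (@le_lt_trans _ _ (lam `[h u, h v]%classic)).
    apply: le_lebesgue => //; first exact: bigcup_measurable.
    by apply: bigcup_sub => k _; have [] := HE k.
  by rewrite [X in (X < _)%E]lebesgue_itv_cc ?hmle// ltry.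
have : (e%:E <= lam (lim_sup_set (fun k => h @` (E k))))%E.
  rewrite -(cvg_lim _ cv)//; apply: lime_ge; first by apply/cvg_ex; eexists; exact: cv.
  apply: nearW => m; have [_ _ _ _ /le_trans] := HE m; apply.
  apply: le_lebesgue => //; first exact: bigcup_measurable.
  by move=> x; exists m => /=.
by rewrite l0 lee_fin leNgt e0.
Qed.

Lemma lusin_cover h (I : countType) (F : I -> R -> R) :
  (forall x, exists i, lusin (F i) /\ h x = F i x) -> lusin h.
Proof.
move=> H A nA.
pose G n : set R := if unpickle n is Some i then
  (if `[< lusin (F i) >] then F i @` A else set0) else set0.
have sub : h @` A `<=` \bigcup_n G n.
  move=> _ [x Ax <-]; have [i [li ->]] := H x.
  by exists (pickle i) => //; rewrite /G pickleK; case: asboolP => // _; exists x.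
apply: negligible_subset sub _; apply: negligible_bigcup => n; rewrite /G.
case: unpickle => [i|]; last exact: negligible_set0.
by case: asboolP => [|_]; [apply|exact: negligible_set0].
Qed.

Lemma lusin_comp h k : lusin h -> lusin k -> lusin (h \o k).
Proof. by move=> lh lk A nA; rewrite -(image_comp k h); apply/lh/lk. Qed.

Lemma lusin_id : lusin (@id R).
Proof. by move=> A; rewrite image_id. Qed.

Lemma lusin_iter h n : lusin h -> lusin (iter n h).
Proof.
move=> lh; elim: n => [|n IH]; first exact: lusin_id.
exact: lusin_comp lh IH.
Qed.

(** Each bounded piece of [A] falls under [ac_lusin_itv], with [d = e / c]. *)
Lemma lusin_lipschitz h (c : R) : 0 < c -> {homo h : x y / x <= y} ->
  (forall x y, x <= y -> h y - h x <= c * (y - x)) -> lusin h.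
Proof.
move=> c0 hh hc A nA.
have -> : A = \bigcup_n (A `&` `[- n.+1%:R, n.+1%:R[%classic).
  apply/seteqP; split=> [x Ax|x [n _ []]//].
  exists (Num.trunc `|x|) => //; split => //=; rewrite in_itv/=.
  have := truncnS_gt `|x|; rewrite ltr_norml => /andP[/ltW -> ->//].
rewrite image_bigcup; apply: negligible_bigcup => n.
apply: (@ac_lusin_itv _ _ (- n.+1%:R) n.+1%:R) => //.
- by rewrite -subr_gt0 opprK -natrD ltr0n.
- move=> e e0; exists (e / c); first exact: divr_gt0.
  move=> m a b ab _; rewrite ltr_pdivlMr// => /le_lt_trans; apply.
  rewrite mulr_suml; apply: ler_sum => i _; rewrite mulrC.
  by apply: hc; have [] := ab i.
- by apply: negligible_subset nA => x [].
Qed.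

Lemma lusin_affine (a b : R) : 0 < a -> lusin (fun x => a * x + b).
Proof.
move=> a0; apply: (lusin_lipschitz a0) => x y xy.
  by rewrite lerD2r ler_pM2l.
by rewrite opprD addrACA subrr addr0 mulrBr.
Qed.

End lusin_converse.
(** * Absolutely continuous homeomorphisms of the line *)

(* [h] stands for an element of AC([0,1]) extended by the identity outside
   [0,1], and [hi] for its inverse; by the Banach-Zaretsky criterion absolute
   continuity is the same as condition (N). *)
Record ac_auto (R : realType) (h hi : R -> R) : Prop := AcAuto {
  acK : cancel h hi ;
  acKi : cancel hi h ;
  ac_homo : {homo h : x y / x < y} ;
  ac_out : forall x, ~~ (0 < x < 1) -> h x = x ;
  ac_lusin : lusin h ;
  ac_lusin_inv : lusin hi
}.

Section ac_auto_theory.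
Variable R : realType.
Implicit Types h k hi ki : R -> R.

Lemma ac_le h hi : ac_auto h hi -> {mono h : x y / x <= y}.
Proof. by move=> H; apply: le_mono; exact: ac_homo H. Qed.

Lemma ac_lt h hi : ac_auto h hi -> {mono h : x y / x < y}.
Proof. by move=> /ac_le /leW_mono. Qed.

Lemma ac_inv h hi : ac_auto h hi -> ac_auto hi h.
Proof.
move=> H; have [hK hiK hh ho lh lhi] := H; split => //.
- by move=> x y xy; rewrite -(ac_lt H) !hiK.
- by move=> x x01; rewrite -{1}(ho _ x01) hK.
Qed.

Lemma ac_continuous h hi : ac_auto h hi -> continuous h.
Proof.
move=> H x; apply/cvgrPdist_lt => e e0; near=> y.
have y1 : h x - e < h y.
  rewrite -(ac_lt (ac_inv H)) (acK H).
  near: y; apply: lt_nbhsr; rewrite -{2}(acK H x) (ac_lt (ac_inv H)); lra.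
have y2 : h y < h x + e.
  rewrite -(ac_lt (ac_inv H)) (acK H).
  near: y; apply: lt_nbhsl; rewrite -{1}(acK H x) (ac_lt (ac_inv H)); lra.
rewrite ltr_norml; apply/andP; split; lra.
Unshelve. all: by end_near. Qed.



End ac_auto_theory.

(** * Passage between [0,1] and the line *)

Section unit_interval_bridge.
Variable R : realType.
Implicit Types (x y : R) (s t : I01 R).

Lemma I01P t : 0 <= val t <= 1.
Proof. by have := set_valP t; rewrite /unit_interval /= in_itv. Qed.

Lemma proj_subproof x : Num.max 0 (Num.min 1 x) \in @unit_interval R.
Proof.
by rewrite inE /unit_interval /= in_itv/= le_max lexx/= ge_max ler01 ge_min lexx.
Qed.

Definition projI x : I01 R := 
  exist (fun x => x \in @unit_interval R) _ (proj_subproof x).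

Lemma projI_val t : projI (val t) = t.
Proof.
apply/val_inj => /=; have /andP[t0 t1] := I01P t.
by rewrite (min_idPr t1) (max_idPr t0).
Qed.

Lemma val_projI x : 0 <= x <= 1 -> val (projI x) = x.
Proof. by move=> /andP[x0 x1] /=; rewrite (min_idPr x1) (max_idPr x0). Qed.

Definition ext (f : I01 R -> I01 R) x : R :=
  if 0 <= x <= 1 then val (f (projI x)) else x.

Lemma ext_val f t : ext f (val t) = val (f t).
Proof. by rewrite /ext I01P projI_val. Qed.

Lemma ext_in f x : 0 <= x <= 1 -> 0 <= ext f x <= 1.
Proof. by rewrite /ext => ->; exact: I01P. Qed.

Lemma extK f g : cancel f g -> cancel (ext f) (ext g).
Proof.
move=> fK x; rewrite {2}/ext; case: ifPn => [x01|/negPf xN].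
  by rewrite ext_val fK val_projI.
by rewrite /ext xN.
Qed.

Lemma ext_homo f : (forall s t, val s < val t -> val (f s) < val (f t)) ->
  {homo ext f : x y / x < y}.
Proof.
move=> H x y xy; have := I01P (f (projI x)); have := I01P (f (projI y)).
rewrite /ext; case: ifPn => x01; case: ifPn => y01; last by [].
- by move=> _ _; apply: H; rewrite !val_projI.
- by move: x01 y01; rewrite !negb_and -!ltNge => /andP[? ?] /orP[]; lra.
- by move: x01 y01; rewrite !negb_and -!ltNge => /orP[] ? /andP[]; lra.
Qed.

(** [ac_lusin_itv] handles the part of [A] in [[0, 1[]; points outside []0, 1[] are fixed and
    contribute only a subset of [A]. *)
Lemma ext_lusin f : {homo ext f : x y / x < y} ->
  (forall x, ~~ (0 < x < 1) -> ext f x = x) ->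
  absolutely_continuous f -> lusin (ext f).
Proof.
move=> fh fo fac A nA.
have sub : ext f @` A `<=` ext f @` (A `&` `[0, 1[%classic) `|` A.
  move=> _ [x Ax <-]; case: (boolP (0 < x < 1)) => [/andP[x0 x1]|xN].
    by left; exists x => //; split => //=; rewrite in_itv/= (ltW x0).
  by right; rewrite fo.
apply: negligible_subset sub _; apply: negligibleU => //.
apply: (@ac_lusin_itv _ _ 0 1 ltr01).
- exact: ltW_homo fh.
- move=> e /fac[d d0 H]; exists d => // n a b uabv tI lt.
  have a01 i : 0 <= a i <= 1 by have [? ? ?] := uabv i; apply/andP; split; lra.
  have b01 i : 0 <= b i <= 1 by have [? ? ?] := uabv i; apply/andP; split; lra.
  rewrite (eq_bigr (fun i => `|val (f (projI (b i))) - val (f (projI (a i)))|)).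
    apply: H.
    + by move=> i; rewrite !val_projI//; have [] := uabv i.
    + by under eq_fun do rewrite !val_projI//.
    + by under eq_bigr do rewrite !val_projI//.
  move=> i _; rewrite /ext a01 b01 ger0_norm// subr_ge0.
  rewrite -!ext_val !val_projI//.
  have [_ + _] := uabv i; rewrite le_eqVlt => /orP[/eqP ->//|/fh/ltW//].
- by move=> x [].
- by apply: negligible_subset nA => x [].
Qed.

Lemma ext_auto (f : AC01 R) : ac_auto (ext f) (ext (homeo_inv f)).
Proof.
have fK := extK (homeo_funK f); have fKi := extK (homeo_invK f).
have fh := ext_homo (@homeo_increasing _ f).
have fm : {mono ext f : x y / x < y} by exact/leW_mono/le_mono.
have fih : {homo ext (homeo_inv f) : x y / x < y}.
  by move=> x y; rewrite -{1}(fKi x) -{1}(fKi y) fm.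
(* An endpoint moved inwards by [f] would have to be moved out of [[0, 1]] by the inverse. *)
have fo x : ~~ (0 < x < 1) -> ext f x = x.
  case: (boolP (0 <= x <= 1)) => [|/negPf xN _]; last by rewrite /ext xN.
  move=> x01 xN.
  have /orP[/eqP xE|/eqP xE] : (x == 0) || (x == 1).
    by move: x01 xN; rewrite negb_and -!leNgt => /andP[? ?] /orP[] ?;
      apply/orP; [left|right]; apply/eqP; lra.
  - rewrite xE; apply/eqP; rewrite eq_le andbC.
    have /andP[-> _] : 0 <= ext f 0 <= 1 by apply: ext_in; rewrite lexx ler01.
    rewrite leNgt; apply/negP => /fih; rewrite fK.
    have /andP[+ _] : 0 <= ext (homeo_inv f) 0 <= 1 by apply: ext_in; rewrite lexx ler01.
    lra.
  - rewrite xE; apply/eqP; rewrite eq_le.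
    have /andP[_ ->] : 0 <= ext f 1 <= 1 by apply: ext_in; rewrite lexx ler01.
    rewrite leNgt; apply/negP => /fih; rewrite fK.
    have /andP[_ +] : 0 <= ext (homeo_inv f) 1 <= 1 by apply: ext_in; rewrite lexx ler01.
    lra.
have fio x : ~~ (0 < x < 1) -> ext (homeo_inv f) x = x.
  by move=> xN; rewrite -{1}(fo _ xN) fK.
split => //.
- exact: (ext_lusin fh fo (AC_fun f)).
- exact: (ext_lusin fih fio (AC_inv f)).
Qed.

Lemma continuous_I01 (h : R -> R) (f : I01 R -> I01 R) :
  continuous h -> (forall t, val (f t) = h (val t)) -> continuous f.
Proof.
move=> hc fE; apply: continuous_comp_initial.
have -> : (set_val \o f) = h \o (set_val : I01 R -> R).
  by apply/funext => t; rewrite /= -fE.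
by move=> t; apply: continuous_comp; [exact: initial_continuous|exact: hc].
Qed.

Lemma ac_auto_ac h hi (f : I01 R -> I01 R) : ac_auto h hi ->
  (forall t, val (f t) = h (val t)) -> absolutely_continuous f.
Proof.
move=> H fE e e0.
have [d d0 {}D] := lusin_ac ler01 (acK H) (acKi H) (ac_le H) (ac_lusin H) e0.
exists d => // n a b ab tI lt.
have -> : \sum_(i < n) `|val (f (b i)) - val (f (a i))| =
    \sum_(i < n) (h (val (b i)) - h (val (a i))).
  by apply: eq_bigr => i _; rewrite !fE ger0_norm// subr_ge0 (ac_le H).
apply: D => // i; have /andP[? _] := I01P (a i); have /andP[_ ?] := I01P (b i).
by split.
Qed.

Lemma ac_in_cc h hi x : ac_auto h hi -> 0 <= x <= 1 -> 0 <= h x <= 1.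
Proof.
move=> H x01; rewrite -{1}(ac_out H (x := 0)) ?ltxx// -{1}(ac_out H (x := 1)) ?ltxx ?andbF//.
by rewrite !(ac_le H).
Qed.

(** With [ext_auto] this gives a dictionary between [AC01 R] and maps of the line; it turns
    homeomorphisms glued on the line back into elements of the group. *)
Lemma ac_autoP h hi : ac_auto h hi ->
  exists f : AC01 R, ext f = h /\ ext (homeo_inv f) = hi.
Proof.
move=> H; have Hi := ac_inv H.
pose f t := projI (h (val t)); pose fi t := projI (hi (val t)).
have fE t : val (f t) = h (val t) by rewrite val_projI// (ac_in_cc H)// I01P.
have fiE t : val (fi t) = hi (val t) by rewrite val_projI// (ac_in_cc Hi)// I01P.
have fK : cancel f fi by move=> t; apply/val_inj; rewrite fiE fE (acK H).
have fiK : cancel fi f by move=> t; apply/val_inj; rewrite fE fiE (acKi H).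
have fc : continuous f by exact: continuous_I01 (ac_continuous H) fE.
have fic : continuous fi by exact: continuous_I01 (ac_continuous Hi) fiE.
have fh s t : val s < val t -> val (f s) < val (f t) by rewrite !fE (ac_lt H).
pose F := MkAC01 (AC_homeo := IncreasingHomeo fK fiK fc fic fh)
  (ac_auto_ac H fE) (ac_auto_ac Hi fiE).
have extE k ki (g : I01 R -> I01 R) : ac_auto k ki ->
    (forall t, val (g t) = k (val t)) -> ext g = k.
  move=> K gE; apply/funext => x; rewrite /ext; case: ifPn => x01.
    by rewrite gE val_projI.
  rewrite (ac_out K)//; apply: contra x01 => /andP[/ltW -> /ltW ->]//.
by exists F; split; [exact: extE H fE|exact: extE Hi fiE].
Qed.

End unit_interval_bridge.

(** * Affine maps between intervals *)

Section affine_maps.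
Variable R : realType.
Implicit Types u v : R.

(** The affine map taking [u] to [u'] and [v] to [v'], written in the shape [a * x + b] of
    [lusin_affine]; [affE] is the form used for computing. *)
Definition aff u v u' v' (z : R) : R :=
  (v' - u') / (v - u) * z + (u' - (v' - u') / (v - u) * u).

Lemma affE u v u' v' z : aff u v u' v' z = u' + (z - u) * ((v' - u') / (v - u)).
Proof. by rewrite /aff; ring. Qed.

Lemma aff_left u v u' v' : aff u v u' v' u = u'.
Proof. by rewrite affE subrr mul0r addr0. Qed.

Lemma aff_right u v u' v' : u < v -> aff u v u' v' v = v'.
Proof. by move=> uv; rewrite affE; field; rewrite subr_eq0 gt_eqF. Qed.

Lemma aff_le u v u' v' : u < v -> u' < v' ->
  {mono aff u v u' v' : x y / x <= y}.
Proof.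
by move=> uv uv' x y; rewrite /aff lerD2r ler_pM2l// divr_gt0// subr_gt0.
Qed.

Lemma aff_lt u v u' v' : u < v -> u' < v' ->
  {mono aff u v u' v' : x y / x < y}.
Proof. by move=> uv uv'; exact/leW_mono/aff_le. Qed.

Lemma affK u v u' v' : u < v -> u' < v' ->
  cancel (aff u v u' v') (aff u' v' u v).
Proof.
by move=> uv uv' z; rewrite !affE; field; rewrite !subr_eq0 !gt_eqF.
Qed.

Lemma aff_lusin u v u' v' : u < v -> u' < v' -> lusin (aff u v u' v').
Proof. by move=> uv uv'; apply: lusin_affine; rewrite divr_gt0// subr_gt0. Qed.

End affine_maps.

(** * Gluing and conjugating *)

Section connectedness.
Variable R : realType.
Implicit Types (Z : set R) (x y z : R).

(** The points [x] and [y] lie in one component of the complement of [Z]; admitting both orders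
    makes the relation symmetric. *)
Definition conn Z x y := forall z, (x <= z <= y) || (y <= z <= x) -> ~ Z z.

Lemma conn_sym Z x y : conn Z x y -> conn Z y x.
Proof. by move=> H z Hz; apply: H; rewrite orbC. Qed.

Lemma conn_trans Z x y z : conn Z x y -> conn Z y z -> conn Z x z.
Proof.
move=> xy yz t Ht; have [ty|/ltW yt] := leP t y; move: Ht => /orP[] /andP[t1 t2].
- by apply: xy; rewrite t1 ty.
- by apply: yz; rewrite t1 ty orbT.
- by apply: yz; rewrite yt t2.
- by apply: xy; rewrite yt t2 orbT.
Qed.

Lemma conn_left Z x y : conn Z x y -> ~ Z x.
Proof. by apply; rewrite lexx/=; case: leP => // /ltW ->. Qed.

Lemma conn_right Z x y : conn Z x y -> ~ Z y.
Proof. by move=> /conn_sym/conn_left. Qed.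

Lemma conn_refl Z x : ~ Z x -> conn Z x x.
Proof. by move=> Zx z; rewrite orbb -eq_le => /eqP <-. Qed.

Lemma conn_between Z x y z : conn Z x y -> x <= z -> z <= y -> conn Z x z.
Proof.
move=> H xz zy t /orP[|] /andP[t1 t2]; apply: H.
- by rewrite t1 (le_trans t2 zy).
- have -> : t = x by apply/eqP; rewrite eq_le t2 (le_trans xz t1).
  by rewrite lexx (le_trans xz zy).
Qed.

Lemma conn_mono Z Z' g gi x y : {mono g : x y / x <= y} -> cancel gi g ->
  (forall x, Z x <-> Z' (g x)) -> conn Z x y -> conn Z' (g x) (g y).
Proof. by move=> gm gK gZ H z; rewrite -(gK z) !gm => /H; rewrite gZ. Qed.

(* [h] modifies [g] inside each component of the complement of [Z]. Condition
   (N) passes to [h] because [h] agrees at every point with one of countably many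
   maps having it. *)
Lemma ac_glue g gi Z h (I : countType) (F Fi : I -> R -> R) :
  ac_auto g gi ->
  (forall x, Z x -> h x = g x) ->
  (forall x, ~~ (0 < x < 1) -> Z x) ->
  (forall x y, x < y -> conn Z x y -> h x < h y) ->
  (forall x, ~ Z x -> conn Z x (gi (h x))) ->
  (forall x, ~ Z x -> exists2 y, conn Z x y & h y = g x) ->
  (forall x, ~ Z x -> exists i,
    [/\ lusin (F i), lusin (Fi i), h x = F i x & Fi i (h x) = x]) ->
  exists hi, ac_auto h hi.
Proof.
move=> G hg Zout hlt hconn honto hF; have Gi := ac_inv G.
have ZK x : Z x -> gi (h x) = x by move=> Zx; rewrite hg// (acK G).
(* By [cl1] and [cl2] the map [gi \o h] carries no point across [Z]; this yields monotonicity for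
   pairs separated by a point of [Z]. *)
have cl1 x z : x < z -> Z z -> gi (h x) < z.
  move=> xz Zz; have [Zx|/hconn xhx] := pselect (Z x); first by rewrite ZK.
  by rewrite ltNge; apply/negP => zx; apply: xhx Zz; rewrite (ltW xz) zx.
have cl2 x z : z < x -> Z z -> z < gi (h x).
  move=> zx Zz; have [Zx|/hconn xhx] := pselect (Z x); first by rewrite ZK.
  by rewrite ltNge; apply/negP => xz; apply: xhx Zz; rewrite (ltW zx) xz orbT.
have hh : {homo h : x y / x < y}.
  move=> x y xy; have [|] := pselect (conn Z x y); first exact: hlt.
  move=> /existsNP[z] /not_implyP[+ /contrapT Zz] => /orP[] /andP[z1 z2]; last first.
    by have := lt_le_trans xy (le_trans z1 z2); rewrite ltxx.
  rewrite -(ac_lt Gi).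
  have [xz|zx] := ltP x z.
    apply: (lt_le_trans (cl1 _ _ xz Zz)).
    by move: z2; rewrite le_eqVlt => /orP[/eqP <-|/cl2/(_ Zz)/ltW//]; rewrite ZK.
  have xzE : x = z by apply: le_anti; rewrite zx z1.
  by rewrite xzE ZK//; apply: cl2 => //; rewrite -xzE.
have hm : {mono h : x y / x <= y} by exact: le_mono.
have onto y : exists x, h x = y.
  have [Zy|/honto[x _ hx]] := pselect (Z (gi y)).
    by exists (gi y); rewrite hg// (acKi G).
  by exists x; rewrite hx (acKi G).
have [hi hiK] := choice onto.
have hK : cancel h hi by move=> x; apply: (inc_inj hm); rewrite hiK.
(* The index [None] stands for [g] itself, the map valid on [Z]. *)
pose FF (i : option I) := if i is Some i then F i else g.
pose FFi (i : option I) := if i is Some i then Fi i else gi.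
exists hi; split => //.
- by move=> x x01; rewrite hg ?(ac_out G)//; exact: Zout.
- apply: (@lusin_cover _ _ _ FF) => x.
  have [Zx|/hF[i [Fl _ hx _]]] := pselect (Z x); last by exists (Some i).
  by exists None; split; [exact: (ac_lusin G)|exact: hg].
- apply: (@lusin_cover _ _ _ FFi) => y.
  have [Zx|/hF[i [_ Fl _]]] := pselect (Z (hi y)); last by rewrite hiK => ?; exists (Some i).
  exists None; split; first exact: (ac_lusin_inv G).
  by rewrite /= -{2}(hiK y) ZK.
Qed.

End connectedness.

(** * Integer iterates and fundamental domains *)

Section int_iter.
Variables (T : Type) (f fi : T -> T).
Hypotheses (fK : cancel f fi) (fiK : cancel fi f).

(** The map and its inverse are both arguments, so that [iz fi f n] is the inverse of
    [iz f fi n]. *)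
Definition iz (f fi : T -> T) (n : int) (x : T) : T :=
  match n with Posz n => iter n f x | Negz n => iter n.+1 fi x end.

Lemma izS n x : iz f fi (n + 1) x = f (iz f fi n x).
Proof.
case: n => [n|[|n]].
- by rewrite -PoszD addn1.
- by rewrite /= fiK.
- have -> : Negz n.+1 + 1 = Negz n by lia.
  by rewrite [RHS]/= fiK.
Qed.

Lemma izSr n x : iz f fi (n + 1) x = iz f fi n (f x).
Proof.
case: n => [n|[|n]].
- by rewrite -PoszD addn1 [LHS]iterSr.
- by rewrite /= fK.
- have -> : Negz n.+1 + 1 = Negz n by lia.
  by rewrite [RHS]iterSr fK.
Qed.

Lemma iterK n : cancel (iter n f) (iter n fi).
Proof. by elim: n => [//|n IH] x; rewrite iterSr /= fK. Qed.

End int_iter.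

Section int_iter_inv.
Variables (T : Type) (f fi : T -> T).
Hypotheses (fK : cancel f fi) (fiK : cancel fi f).

Lemma izK n : cancel (iz f fi n) (iz fi f n).
Proof. by case: n => n x; rewrite /iz iterK. Qed.

Lemma iz_ind (Q : T -> Prop) n x : (forall y, Q y -> Q (f y)) ->
  (forall y, Q y -> Q (fi y)) -> Q x -> Q (iz f fi n x).
Proof.
move=> Qf Qi Qx; case: n => n; rewrite /iz; elim: n => [|n IH] //=; first exact: Qf.
- exact: Qi.
- exact/Qi.
Qed.

End int_iter_inv.
Section fundamental_domains.
Variable R : realType.
Variables f fi : R -> R.
Hypothesis Hf : ac_auto f fi.

Let fK := acK Hf.
Let fiK := acKi Hf.

(* The complement of the set where [f] moves points up. *)
Definition nonup (f : R -> R) : set R := [set x | ~ x < f x].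

Lemma not_nonup k x : ~ nonup k x <-> x < k x.
Proof. by split=> [/contrapT//|? []]. Qed.

Lemma nonup_lt k x y : conn (nonup k) x y -> x < k x.
Proof. by move=> /conn_left /not_nonup. Qed.

Lemma nonup_out x : ~~ (0 < x < 1) -> nonup f x.
Proof. by move=> /(ac_out Hf) fx; rewrite /nonup/= fx ltxx. Qed.

(** For [x <= z <= f x] monotonicity gives [z <= f x <= f z], and [z = f z] would force [x = z], a
    fixed point. *)
Lemma conn_step x : x < f x -> conn (nonup f) x (f x).
Proof.
move=> xf z /orP[/andP[xz zf]|/andP[fz zx]]; last first.
  by have := lt_le_trans xf (le_trans fz zx); rewrite ltxx.
apply/not_nonup; rewrite lt_neqAle (le_trans zf) ?(ac_le Hf)// andbT.
apply/eqP => zE; have fxz : f x = z.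
  by apply: le_anti; rewrite {1}zE (ac_le Hf) xz zf.
by move: xf; rewrite fxz -(can_inj fK (etrans fxz zE)) ltxx.
Qed.

Lemma up_fi y : y < f y -> fi y < f (fi y).
Proof. by move=> yf; rewrite -(ac_lt Hf) fiK. Qed.

Lemma conn_iz n x : x < f x -> conn (nonup f) x (iz f fi n x).
Proof.
move=> xf; apply: (iz_ind (Q := conn (nonup f) x)).
- by move=> y xy; apply: (conn_trans xy); apply/conn_step/nonup_lt/conn_sym/xy.
- move=> y xy; apply: (conn_trans xy); apply: conn_sym; rewrite -{2}(fiK y).
  by apply/conn_step/up_fi/nonup_lt/conn_sym/xy.
- exact/conn_refl/not_nonup.
Qed.

Lemma iz_le n : {mono iz f fi n : x y / x <= y}.
Proof.
move=> x y; case: n => n; rewrite /iz.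
  by elim: n => //= n IH; rewrite (ac_le Hf).
elim: n => [|n IH]; first by rewrite /= (ac_le (ac_inv Hf)).
by rewrite !(iterS n.+1) (ac_le (ac_inv Hf)).
Qed.

Lemma iz_lt n : {mono iz f fi n : x y / x < y}.
Proof. exact/leW_mono/iz_le. Qed.

Lemma iz_incr r n m : r < f r -> n <= m -> iz f fi n r <= iz f fi m r.
Proof.
move=> rf; rewrite -subr_ge0 => nm; have -> : m = n + `|m - n|%N by lia.
elim: `|m - n|%N => [|k IH]; first by rewrite addr0.
apply: (le_trans IH); rewrite -addn1 PoszD addrA izS//.
exact/ltW/nonup_lt/conn_sym/conn_iz.
Qed.

(** If the iterates stayed below [x], their supremum would lie in the component and be moved up by
    [f]. Some iterate would then exceed its preimage, and the next one would exceed the supremum. *)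
Lemma iter_escape r x : conn (nonup f) r x -> exists n : nat, x < iter n f r.
Proof.
move=> rx; apply: contrapT => /forallNP H.
have le n : iter n f r <= x by rewrite leNgt; apply/negP/H.
pose S := range (fun n => iter n f r).
have ubS : ubound S x by move=> _ [n _ <-].
have S0 : S !=set0 by exists r, 0%N.
have hs : has_ubound S by exists x.
have rs : r <= sup S by apply: ub_le_sup => //; exists 0%N.
have sx : sup S <= x by exact: ge_sup.
have sf : sup S < f (sup S) by apply/not_nonup/rx; rewrite rs sx.
have fs0 : 0 < sup S - fi (sup S).
  by rewrite subr_gt0 -(ac_lt Hf) fiK.
have [_ [n _ <-]] := sup_adherent fs0 (conj S0 hs).
rewrite subKr -(ac_lt Hf) fiK => lt1.
have le1 : iter n.+1 f r <= sup S by apply: ub_le_sup => //; exists n.+1.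
by have := lt_le_trans lt1 le1; rewrite ltxx.
Qed.

Lemma fundamental r x : conn (nonup f) r x ->
  exists n : int, iz f fi n r <= x < iz f fi (n + 1) r.
Proof.
move=> rx; have [le_rx|lt_xr] := leP r x.
  have [n] := ex_minnP (iter_escape rx).
  case: n => [|n xn min]; first by rewrite /= ltNge le_rx.
  exists n; rewrite izS// xn andbT leNgt.
  by apply/negP => /min; rewrite ltnn.
(* Here [x < r]: the iterates of [x] escape upwards past [r], and applying the inverse iterates then
   locates [x] among those of [r]. *)
have [m] := ex_minnP (iter_escape (conn_sym rx)).
case: m => [|m rm min]; first by move=> /(lt_trans lt_xr); rewrite ltxx.
have mr : iter m f x <= r by rewrite leNgt; apply/negP => /min; rewrite ltnn.
have E k : iz f fi (Negz k) (iter k.+1 f x) = x by exact: (iterK fK k.+1).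
have x1 : iz f fi (Negz m) r < x.
  by have := iz_lt (Negz m) r (iter m.+1 f x); rewrite rm E.
have x2 : x <= iz f fi (Negz m + 1) r.
  rewrite izS//= fiK.
  by case: m mr {rm min x1} => [//|m] mr; have := iz_le (Negz m) (iter m.+1 f x) r; rewrite mr E.
(* Inverting the iterates gives an interval closed on the right; if [x] is its right end, it belongs
   to the next domain. *)
move: x2; rewrite le_eqVlt => /orP[/eqP xE|x2]; last first.
  by exists (Negz m); rewrite (ltW x1).
exists (Negz m + 1); rewrite -xE lexx izS// -xE.
exact/nonup_lt/conn_sym/rx.
Qed.

Lemma fundamental_le r x y n m : r < f r -> x <= y ->
  iz f fi n r <= x < iz f fi (n + 1) r ->
  iz f fi m r <= y < iz f fi (m + 1) r -> n <= m.
Proof.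
move=> rf xy /andP[x1 _] /andP[_ y2]; rewrite leNgt; apply/negP => mn.
have := le_lt_trans (le_trans x1 xy) y2.
by rewrite ltNge iz_incr// ?lezD1.
Qed.

Lemma fundamental_uniq r x n m : r < f r ->
  iz f fi n r <= x < iz f fi (n + 1) r ->
  iz f fi m r <= x < iz f fi (m + 1) r -> n = m.
Proof.
by move=> rf xn xm; apply: le_anti; rewrite !(fundamental_le rf (lexx x)).
Qed.

Lemma ratr_conn x : x < f x -> exists q : rat, conn (nonup f) x (ratr q).
Proof.
move=> xf; have [q] := rat_in_itvoo xf; rewrite in_itv/= => /andP[xq qf].
exists q; apply: conn_between (conn_step xf) _ _; exact: ltW.
Qed.

(* A rational point in the component of [x]; it depends on the component only. *)
Definition base x : rat := xget 0 [set q : rat | conn (nonup f) x (ratr q)].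

Lemma base_conn x : x < f x -> conn (nonup f) x (ratr (base x)).
Proof. by move=> /ratr_conn; exact: (@xgetPex _ 0 [set q : rat | _]). Qed.

Lemma base_eq x y : conn (nonup f) x y -> base x = base y.
Proof.
move=> xy; rewrite /base; congr xget; apply/seteqP; split=> q /=.
  exact/conn_trans/conn_sym/xy.
exact: conn_trans.
Qed.

End fundamental_domains.

(** * Conjugacies with prescribed fixed points and signs *)

Section conjugation.
Variable R : realType.
Implicit Types f g h : R -> R.

(* On the fundamental domain from [r] to [f1 r], where [r] is the base point, [h]
   is affine onto the one from [g r] to [f2 (g r)]; it is extended to the
   component by equivariance. *)
Lemma conj_up f1 f1i f2 f2i g gi :
  ac_auto f1 f1i -> ac_auto f2 f2i -> ac_auto g gi ->
  (forall x, (x < f1 x) = (g x < f2 (g x))) ->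
  exists h hi, [/\ ac_auto h hi,
    forall x, ~~ (x < f1 x) -> h x = g x &
    forall x, x < f1 x -> h (f1 x) = f2 (h x)].
Proof.
move=> H1 H2 G up.
have f1K := acK H1; have f1iK := acKi H1; have f2K := acK H2; have f2iK := acKi H2.
have cg x y : conn (nonup f1) x y -> conn (nonup f2) (g x) (g y).
  apply: conn_mono (ac_le G) (acKi G) _ => z; rewrite /nonup /= up//.
have cgi x y : conn (nonup f2) x y -> conn (nonup f1) (gi x) (gi y).
  apply: conn_mono (ac_le (ac_inv G)) (acK G) _ => z.
  by rewrite /nonup /= up (acKi G).
pose L (q : rat) := let r := ratr q : R in aff r (f1 r) (g r) (f2 (g r)).
pose Li (q : rat) := let r := ratr q : R in aff (g r) (f2 (g r)) r (f1 r).
(* On the [n]-th domain equivariance forces [f2^n \o L \o f1^-n]. A rational base point and an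
   integer index these maps, so there are countably many. *)
pose F (i : rat * int) := iz f2 f2i i.2 \o L i.1 \o iz f1i f1 i.2.
pose Fi (i : rat * int) := iz f1 f1i i.2 \o Li i.1 \o iz f2i f2 i.2.
have lusin_iz k ki n : ac_auto k ki -> lusin (iz k ki n).
  move=> K; case: n => n; apply: lusin_iter; [exact: ac_lusin K|exact: ac_lusin_inv K].
pose dom n (r x : R) := iz f1 f1i n r <= x < iz f1 f1i (n + 1) r.
pose N x : int := xget 0 [set n | dom n (ratr (base f1 x)) x].
have NP x : x < f1 x -> dom (N x) (ratr (base f1 x)) x.
  move=> xf; apply: (@xgetPex _ 0 [set n | dom n _ x]).
  exact/(fundamental H1)/conn_sym/(base_conn H1).
have bup x : x < f1 x -> (ratr (base f1 x) : R) < f1 (ratr (base f1 x)).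
  by move=> xf; apply: nonup_lt; apply: conn_sym; exact: (base_conn H1).
have N_uniq x n : x < f1 x -> dom n (ratr (base f1 x)) x -> N x = n.
  by move=> xf; apply: (fundamental_uniq H1 (bup _ xf)); exact: NP.
pose h x := if x < f1 x then F (base f1 x, N x) x else g x.
have gup x : x < f1 x -> g x < f2 (g x) by rewrite up.
have Lle q : (ratr q : R) < f1 (ratr q) -> {mono L q : x y / x <= y}.
  by move=> qf; apply: aff_le => //; exact: gup.
have Llt q : (ratr q : R) < f1 (ratr q) -> {mono L q : x y / x < y}.
  by move=> qf; apply: aff_lt => //; exact: gup.
have Ll q : L q (ratr q) = g (ratr q) by exact: aff_left.
have Lr q : (ratr q : R) < f1 (ratr q) -> L q (f1 (ratr q)) = f2 (g (ratr q)).
  by move=> qf; exact: aff_right.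
have LK q : (ratr q : R) < f1 (ratr q) -> cancel (L q) (Li q).
  by move=> qf; apply: affK => //; exact: gup.
have LiK q : (ratr q : R) < f1 (ratr q) -> cancel (Li q) (L q).
  by move=> qf; apply: affK => //; exact: gup.
have domE n r x : dom n r x = (r <= iz f1i f1 n x < f1 r).
  rewrite /dom izSr// -(iz_le H1 n r (iz f1i f1 n x)) -(iz_lt H1 n (iz f1i f1 n x)).
  by rewrite (izK f1iK f1K).
have hdom x : x < f1 x ->
    iz f2 f2i (N x) (g (ratr (base f1 x))) <= h x <
    iz f2 f2i (N x + 1) (g (ratr (base f1 x))).
  move=> xf; have := NP x xf; rewrite domE /h xf /F/= => /andP[x1 x2].
  rewrite izSr// (iz_le H2) (iz_lt H2).
  by rewrite -(Lr _ (bup _ xf)) -Ll (Lle _ (bup _ xf)) x1 (Llt _ (bup _ xf)).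
have hconn2 x : x < f1 x -> conn (nonup f2) (g (ratr (base f1 x))) (h x).
  move=> xf; have /andP[h1 h2] := hdom x xf.
  have c n : conn (nonup f2) _ (iz f2 f2i n _) := conn_iz H2 (gup _ (bup _ xf)).
  apply: conn_trans (c (N x)) _; apply: conn_between h1 (ltW h2).
  exact: conn_trans (conn_sym (c (N x))) (c _).
have hconn1 x : ~ nonup f1 x -> conn (nonup f1) x (gi (h x)).
  move=> /not_nonup xf; apply: conn_trans (base_conn H1 xf) _.
  by have := cgi _ _ (hconn2 _ xf); rewrite (acK G).
have [||||||hi Hh] := @ac_glue _ g gi (nonup f1) h (rat * int)%type F Fi G.
- by move=> x /negP/negPf xf; rewrite /h xf.
- exact: nonup_out H1.
- move=> x y xy cxy.
  have xf := nonup_lt cxy; have yf := nonup_lt (conn_sym cxy).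
  have bxy := base_eq cxy.
  have rf := bup _ xf.
  have NPy := NP _ yf; rewrite -bxy in NPy.
  have := fundamental_le H1 rf (ltW xy) (NP _ xf) NPy; rewrite le_eqVlt => /orP[/eqP nxy|nxy].
    rewrite /h xf yf /F/= -bxy -nxy (iz_lt H2) (Llt _ rf).
    by rewrite (iz_lt (ac_inv H1)).
  have /andP[_ /lt_le_trans] := hdom _ xf; apply.
  have /andP[+ _] := hdom _ yf; apply: le_trans; rewrite -bxy.
  by apply: (iz_incr H2); [exact: gup|rewrite lezD1].
- exact: hconn1.
- move=> x /not_nonup xf; have rf := bup _ xf.
  set q := base f1 x in rf *.
  (* Surjectivity is obtained by running the construction backwards: [n] locates [g x] among the
     domains of [f2], and its preimage [y] lies in the domain of [f1] with the same index. *)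
  have [n nx] := fundamental H2 (cg _ _ (conn_sym (base_conn H1 xf))).
  pose z := Li q (iz f2i f2 n (g x)).
  pose y := iz f1 f1i n z.
  have LzE : L q z = iz f2i f2 n (g x) by rewrite LiK.
  have zr : ratr q <= z < f1 (ratr q).
    rewrite -(Lle _ rf) -(Llt _ rf) LzE Ll Lr//.
    rewrite -(iz_le H2 n) -(iz_lt H2 n (iz _ _ _ _)) -izSr// !(izK f2iK f2K)//.
  have dy : dom n (ratr q) y by rewrite domE /y (izK f1K f1iK).
  have cy : conn (nonup f1) (ratr q) y.
    have c m : conn (nonup f1) _ (iz f1 f1i m _) := conn_iz H1 rf.
    have /andP[y1 y2] := dy.
    apply: conn_trans (c n) _; apply: conn_between y1 (ltW y2).
    exact: conn_trans (conn_sym (c n)) (c _).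
  have cxy := conn_trans (base_conn H1 xf) cy.
  exists y => //; have yf := nonup_lt (conn_sym cxy).
  have byq : base f1 y = q by rewrite /q (base_eq cxy).
  have Ny : N y = n by apply: N_uniq => //; rewrite byq.
  rewrite /h yf byq Ny /F/= /y (izK f1K f1iK) LzE (izK f2iK f2K)//.
- move=> x /not_nonup xf; exists (base f1 x, N x); have rf := bup _ xf.
  split.
  + apply: lusin_comp; last exact/lusin_iz/ac_inv.
    apply: lusin_comp; first exact/lusin_iz.
    by apply: aff_lusin => //; exact: gup.
  + apply: lusin_comp; last exact/lusin_iz/ac_inv.
    apply: lusin_comp; first exact/lusin_iz.
    by apply: aff_lusin => //; exact: gup.
  + by rewrite /h xf.
  + by rewrite /h xf /Fi /F/= (izK f2K f2iK) LK// (izK f1iK f1K).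
exists h, hi; split => //; first by move=> x /negPf xf; rewrite /h xf.
move=> x xf; have cx := conn_step H1 xf.
have ff := nonup_lt (conn_sym cx).
have bE := base_eq cx.
have /andP[n1 n2] := NP _ xf.
have NE : N (f1 x) = N x + 1.
  apply: N_uniq => //; rewrite -bE /dom izS// (ac_le H1) n1.
  by rewrite izS// (ac_lt H1).
by rewrite /h xf ff /F/= -bE NE izS// izSr// f1K.
Qed.

(* [conj_up] for [f1] and [f2], then for their inverses. *)
Lemma conj_ac_auto f1 f1i f2 f2i g gi :
  ac_auto f1 f1i -> ac_auto f2 f2i -> ac_auto g gi ->
  (forall x, (x < f1 x) = (g x < f2 (g x))) ->
  (forall x, (f1 x < x) = (f2 (g x) < g x)) ->
  exists h hi, ac_auto h hi /\ forall x, h (f1 x) = f2 (h x).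
Proof.
move=> H1 H2 G up down.
have [k [ki [K kg kf]]] := conj_up H1 H2 G up.
have kdown x : (x < f1i x) = (k x < f2i (k x)).
  rewrite -(ac_lt H1) (acKi H1) -[RHS](ac_lt H2) (acKi H2).
  have [xf|fx] := boolP (x < f1 x); last by rewrite kg.
  have := xf; rewrite -(ac_lt K) kf// => kx.
  by apply/idP/idP => [/(lt_trans xf)|/(lt_trans kx)]; rewrite ltxx.
(* Starting from [k] instead of [g] keeps what is already achieved: [h] differs from [k] only at
   points moved down by [f1]. *)
have [h [hi [H hk hf]]] := conj_up (ac_inv H1) (ac_inv H2) K kdown.
exists h, hi; split => // x.
have dE z : (z < f1i z) = (f1 z < z) by rewrite -(ac_lt H1) (acKi H1).
have [xf|fx] := boolP (x < f1 x).
  rewrite !hk ?kf// dE -leNgt; first by rewrite ltW.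
  by rewrite ltW// (ac_lt H1).
have [fx'|xf'] := boolP (f1 x < x).
  have := hf (f1 x); rewrite (acK H1) => /(_ fx') ->.
  by rewrite (acKi H2).
have fxE : f1 x = x by apply: le_anti; rewrite !leNgt fx xf'.
rewrite fxE hk ?dE// kg//; apply: esym; apply: le_anti; rewrite !leNgt -up -down.
by rewrite fx xf'.
Qed.

End conjugation.
(** * Encoding the fixed points and the signs in a closed set *)

Section markers.
Variable R : realType.
Implicit Types (f g h : R -> R) (K : set R) (a b x y z : R).

Definition fixset f : set R := [set x | f x = x].

Definition fix_gap f a b :=
  [/\ a < b, f a = a, f b = b & forall z, a < z < b -> f z <> z].

Definition last_fix f x := sup [set z | z <= x /\ f z = z].
Definition next_fix f x := inf [set z | x <= z /\ f z = z].

(* Between consecutive fixed points [a < b], the markers are the [x] such that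
   [(b - a) / (x - a)] lies in [[n, n + e]] for some [n >= 2], with [e = 0] (isolated
   points) where [f] moves points up and [e = 1/2] (intervals) where it moves them
   down. *)
Definition marker f x := exists a b (n : nat),
  [/\ fix_gap f a b, a < x < b, (2 <= n)%N, n%:R * (x - a) <= b - a &
      b - a <= (n%:R + if x < f x then 0 else 2^-1) * (x - a)].

Definition markset f : set R := [set x | f x = x \/ marker f x].

(* [y] lies in a component [[c, d]] of [K] that is open in [K]: a point if [s],
   a nontrivial interval otherwise. *)
Definition block (s : bool) K y := exists p c d q,
  [/\ p < c, c <= y <= d, d < q, (if s then c = d else c < d) &
      forall z, p < z < q -> (K z <-> c <= z <= d)].

(** Defined from the order and [K] alone, hence carried along by increasing homeomorphisms. When [K]
    is a [markset], a suitable [u] exists to the left of every [x] in a gap of the right sign, as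
    markers accumulate at the left end of the gap. *)
Definition block_region (s : bool) K x := exists u,
  [/\ u <= x, K u & forall y, u <= y <= x -> K y -> block s K y].

Lemma block_mono s K1 K2 g gi y : ac_auto g gi -> (forall x, K1 x <-> K2 (g x)) ->
  block s K1 y -> block s K2 (g y).
Proof.
move=> G KK [p [c [d [q [pc cyd dq scd H]]]]].
exists (g p), (g c), (g d), (g q); split; rewrite ?(ac_le G) ?(ac_lt G)//.
  by case: s scd => /= [->|]; rewrite ?(ac_lt G).
by move=> z; rewrite -(acKi G z) !(ac_le G) !(ac_lt G) -KK => /H.
Qed.

Lemma block_region_mono s K1 K2 g gi x : ac_auto g gi ->
  (forall x, K1 x <-> K2 (g x)) ->
  block_region s K1 x -> block_region s K2 (g x).
Proof.
move=> G KK [u [ux Ku H]]; exists (g u); split; rewrite ?(ac_le G)//.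
  exact/KK.
move=> y; rewrite -(acKi G y) !(ac_le G) -KK => uyx Ky.
exact/(block_mono G KK)/H.
Qed.

Lemma block_excl K y : block true K y -> block false K y -> False.
Proof.
move=> [p [c [d [q [pc /andP[cy yd] dq cd H]]]]].
move=> [p' [c' [d' [q' [pc' /andP[cy' yd'] dq' cd' H']]]]].
have [yd''|d'y] := ltP y d'.
  have [z [z1 z2 z3]] : exists z, [/\ y < z, z < q & z <= d'].
    exists (Num.min ((y + q) / 2) d'); split; last by rewrite ge_min lexx orbT.
      by rewrite lt_min yd'' andbT; lra.
    by rewrite gt_min; apply/orP; left; lra.
  have Kz : K z by apply/H'; apply/andP; split; lra.
  have Hz : p < z < q by apply/andP; split; lra.
  have /andP[] := (H z Hz).1 Kz.
  lra.
have [z [z1 z2 z3]] : exists z, [/\ z < y, p < z & c' <= z].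
  exists (Num.max ((y + p) / 2) c'); split; last by rewrite le_max lexx orbT.
    by rewrite gt_max; apply/andP; split; lra.
  by rewrite lt_max; apply/orP; left; lra.
have Kz : K z by apply/H'; apply/andP; split; lra.
have Hz : p < z < q by apply/andP; split; lra.
  have /andP[] := (H z Hz).1 Kz.
lra.
Qed.

Section fixed.
Variables (f fi : R -> R).
Hypothesis Hf : ac_auto f fi.

(** There are fixed points below [x] since everything outside []0, 1[] is fixed. Their supremum is
    fixed by monotonicity: otherwise a fixed point close enough to it would have to move. *)
Lemma last_fixP x : [/\ last_fix f x <= x, f (last_fix f x) = last_fix f x &
  forall z, z <= x -> f z = z -> z <= last_fix f x].
Proof.
rewrite /last_fix; set S := [set z | _].
have S0 : S !=set0.
  exists (Num.min x 0); split; first by rewrite ge_min lexx.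
  by apply: (ac_out Hf); rewrite negb_and -!leNgt ge_min lexx orbT.
have ubS : ubound S x by move=> z [].
have hs : has_ubound S by exists x.
split.
- exact: ge_sup.
- apply: le_anti; rewrite !leNgt; apply/andP; split; apply/negP => lt.
  + have d0 : 0 < sup S - fi (sup S) by rewrite subr_gt0 -(ac_lt Hf) (acKi Hf).
    have [z [zx fz]] := sup_adherent d0 (conj S0 hs).
    rewrite subKr -(ac_lt Hf) (acKi Hf) fz.
    by rewrite ltNge ub_le_sup.
  + have d0 : 0 < sup S - f (sup S) by rewrite subr_gt0.
    have [z [zx fz]] := sup_adherent d0 (conj S0 hs).
    by rewrite subKr -{1}fz (ac_lt Hf) ltNge ub_le_sup.
- by move=> z zx fz; apply: ub_le_sup.
Qed.

Lemma next_fixP x : [/\ x <= next_fix f x, f (next_fix f x) = next_fix f x &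
  forall z, x <= z -> f z = z -> next_fix f x <= z].
Proof.
rewrite /next_fix; set S := [set z | _].
have S0 : S !=set0.
  exists (Num.max x 1); split; first by rewrite le_max lexx.
  by apply: (ac_out Hf); rewrite negb_and -!leNgt le_max lexx !orbT.
have lbS : lbound S x by move=> z [].
have hs : has_lbound S by exists x.
split.
- exact: lb_le_inf.
- apply: le_anti; rewrite !leNgt; apply/andP; split; apply/negP => lt.
  + have d0 : 0 < f (inf S) - inf S by rewrite subr_gt0.
    have [z [zx fz]] := inf_adherent d0 (conj S0 hs).
    by rewrite addrC subrK -{1}fz (ac_lt Hf) ltNge ge_inf.
  + have d0 : 0 < fi (inf S) - inf S by rewrite subr_gt0 -(ac_lt Hf) (acKi Hf).
    have [z [zx fz]] := inf_adherent d0 (conj S0 hs).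
    rewrite addrC subrK -(ac_lt Hf) (acKi Hf) fz.
    by rewrite ltNge ge_inf.
- by move=> z zx fz; apply: ge_inf.
Qed.

Lemma last_fix_lt x : f x <> x -> last_fix f x < x.
Proof.
move=> fx; have [+ fl _] := last_fixP x; rewrite le_eqVlt => /orP[/eqP xE|//].
by rewrite xE in fl.
Qed.

Lemma next_fix_gt x : f x <> x -> x < next_fix f x.
Proof.
move=> fx; have [+ fl _] := next_fixP x; rewrite le_eqVlt => /orP[/eqP xE|//].
by rewrite -xE in fl.
Qed.

Lemma fix_gapP x : f x <> x -> fix_gap f (last_fix f x) (next_fix f x).
Proof.
move=> fx; have [l1 l2 l3] := last_fixP x; have [r1 r2 r3] := next_fixP x.
have lx := last_fix_lt fx; have xr := next_fix_gt fx.
split => //; first exact: lt_trans xr.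
move=> z /andP[z1 z2] fz; have [zx|/ltW xz] := leP z x.
  by have := l3 _ zx fz; rewrite leNgt z1.
by have := r3 _ xz fz; rewrite leNgt z2.
Qed.

Lemma fix_gap_uniq a b a' b' x : fix_gap f a b -> fix_gap f a' b' ->
  a < x < b -> a' < x < b' -> a = a' /\ b = b'.
Proof.
move=> [ab fa fb H] [ab' fa' fb' H'] /andP[ax xb] /andP[ax' xb']; split; apply: le_anti.
- apply/andP; split; rewrite leNgt; apply/negP => lt.
  + by apply: (H' a) => //; rewrite lt (lt_trans ax).
  + by apply: (H a') => //; rewrite lt (lt_trans ax').
- apply/andP; split; rewrite leNgt; apply/negP => lt.
  + by apply: (H b') => //; rewrite lt (lt_trans ax).
  + by apply: (H' b) => //; rewrite lt (lt_trans ax').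
Qed.

Lemma fix_gap_last a b x : fix_gap f a b -> a < x < b ->
  last_fix f x = a /\ next_fix f x = b.
Proof.
move=> ab xab; have fx : f x <> x by case: ab => _ _ _; apply.
by apply: (fix_gap_uniq (fix_gapP fx) ab) xab; rewrite last_fix_lt// next_fix_gt.
Qed.

Lemma fix_gap_conn a b x y : fix_gap f a b -> a < x < b -> a < y < b ->
  conn (fixset f) x y.
Proof.
move=> [_ _ _ H] /andP[x1 x2] /andP[y1 y2] z /orP[] /andP[z1 z2]; apply: H.
  by rewrite (lt_le_trans x1) //= (le_lt_trans z2).
by rewrite (lt_le_trans y1) //= (le_lt_trans z2).
Qed.

Lemma conn_fix_gap a b x y : fix_gap f a b -> a < x < b ->
  conn (fixset f) x y -> a < y < b.
Proof.
move=> [ab fa fb _] /andP[x1 x2] xy; rewrite !ltNge; apply/andP; split; apply/negP => yab.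
  by apply: (xy a) => //; rewrite yab (ltW x1) orbT.
by apply: (xy b) => //; rewrite yab (ltW x2).
Qed.

Lemma conn_fix_sign x y : conn (fixset f) x y -> (x < f x) = (y < f y).
Proof.
wlog xy : x y / x <= y => [W c|].
  have [/W->//|/ltW/W yx] := leP x y.
  by rewrite yx//; exact: conn_sym.
move=> c.
have fx := conn_left c; have fy := conn_right c.
have main : (f x <= x) && (y <= f y) || (x <= f x) && (f y <= y) -> False.
  move=> H; have cf : {within `[x, y], continuous (fun z => f z - z)}.
    apply: continuous_subspaceT => z; apply: cvgB; last exact: cvg_id.
    exact: (ac_continuous Hf).
  have mm : Num.min (f x - x) (f y - y) <= 0 <= Num.max (f x - x) (f y - y).
    rewrite ge_min le_max !subr_le0 !subr_ge0.
    by case/orP: H => /andP[-> ->]; rewrite ?orbT.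
  have [z] := IVT xy cf mm; rewrite in_itv/= => zxy fz.
  by apply: (c z); rewrite ?zxy// /fixset/=; apply/eqP; rewrite -subr_eq0 fz.
apply/idP/idP => H; rewrite ltNge; apply/negP => H'; apply: main.
  by rewrite (ltW H) H' orbT.
by rewrite (ltW H) H'.
Qed.

End fixed.
End markers.

(** * Recovering fixed points and signs from the markers *)

Section markers_theory.
Variable R : realType.
Implicit Types (f g h : R -> R) (K : set R) (a b x y z : R).

Section single.
Variables (f fi : R -> R).
Hypothesis Hf : ac_auto f fi.

Lemma markerE a b x : fix_gap f a b -> a < x < b ->
  marker f x <-> exists n : nat, [/\ (2 <= n)%N, n%:R * (x - a) <= b - a &
      b - a <= (n%:R + if x < f x then 0 else 2^-1) * (x - a)].
Proof.
move=> ab xab; split=> [[a' [b' [n [ab' xab' n2 h1 h2]]]]|[n [n2 h1 h2]]].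
  have [aE bE] := fix_gap_uniq ab ab' xab xab'; subst a' b'.
  by exists n.
by exists a, b, n.
Qed.

Lemma nfix_markset x : f x <> x -> markset f x <-> marker f x.
Proof. by move=> fx; split=> [[]|]//; right. Qed.

Lemma gap_sign a b x y : fix_gap f a b -> a < x < b -> a < y < b ->
  (x < f x) = (y < f y).
Proof. by move=> ab xab yab; exact/(conn_fix_sign Hf)/(fix_gap_conn ab). Qed.

Lemma nat_lt_frac (n m : nat) (r s : R) : 0 <= r < 1 -> 0 <= s -> n%:R + s < m%:R + r -> (n <= m)%N.
Proof.
move=> /andP[r0 r1] s0 nm; rewrite -ltnS -(ltr_nat R) -natr1; lra.
Qed.

Lemma marker_block x : marker f x -> block (x < f x) (markset f) x.
Proof.
move=> [a [b [n [ab /[dup] xab /andP[ax xb] n2 h1 h2]]]].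
have [aLb fa fb H] := ab.
set e := (if x < f x then 0 else 2^-1 : R) in h2 *.
have e0 : 0 <= e by rewrite /e; case: ifP => //; lra.
have e1 : e <= 2^-1 by rewrite /e; case: ifP => // _; lra.
have n2R : 2 <= n%:R :> R by rewrite (ler_nat _ 2).
set l := b - a in h1 h2 *.
have l0 : 0 < l by rewrite /l; lra.
have P k z : 0 < k -> (a + l / k <= z) = (l <= k * (z - a)).
  by move=> k0; rewrite -lerBrDl ler_pdivrMr// mulrC.
have P' k z : 0 < k -> (z <= a + l / k) = (k * (z - a) <= l).
  by move=> k0; rewrite -lerBlDl ler_pdivlMr// mulrC.
have k1 : 0 < n%:R + e by lra.
have k2 : 0 < n%:R :> R by lra.
have k3 : 0 < n%:R + 3 / 4 :> R by lra.
have k4 : 0 < n%:R - 4^-1 :> R by lra.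
have D k k' : 0 < k -> k < k' -> a + l / k' < a + l / k.
  move=> k0 kk; rewrite ltrD2l ltr_pM2l// ltf_pV2 ?posrE//; lra.
(* In terms of the ratio [l / (z - a)] the markers fill [[m, m + e]] with [e <= 1/2], so [n + 3/4]
   and [n - 1/4] separate the [n]-th from its neighbours. As [n >= 2], the second exceeds 1 and the
   neighbourhood stays inside the gap. *)
exists (a + l / (n%:R + 3 / 4)), (a + l / (n%:R + e)), (a + l / n%:R), (a + l / (n%:R - 4^-1)).
split.
- by apply: D; lra.
- by rewrite P// P'// h2 h1.
- by apply: D; lra.
- case: ifP => xf; rewrite /e xf ?addr0//.
  by apply: D; lra.
move=> z /andP[z1 z2].
have z1' : l < (n%:R + 3 / 4) * (z - a) by rewrite ltNge -P'// -ltNge.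
have z2' : (n%:R - 4^-1) * (z - a) < l by rewrite ltNge -P// -ltNge.
have az : a < z by apply: lt_trans z1; rewrite ltrDl divr_gt0.
have zb : z < b.
  have -> : b = a + l / 1 by rewrite /l; field.
  by apply: (lt_trans z2); apply: D; lra.
have zab : a < z < b by rewrite az zb.
rewrite nfix_markset; last exact: H.
rewrite (markerE ab zab) (gap_sign ab zab xab) -/e -/l.
split=> [[m [m2 m3 m4]]|].
  have t0 : 0 < z - a by rewrite subr_gt0.
  have mn : (m <= n)%N.
    apply: (@nat_lt_frac _ _ (3 / 4) 0) => //; first by apply/andP; split; lra.
    by rewrite addr0 -(ltr_pM2r t0); lra.
  have nm : (n <= m)%N.
    apply: (@nat_lt_frac _ _ (3 / 4) 0) => //; first by apply/andP; split; lra.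
    have : n%:R - 4^-1 < m%:R + e by rewrite -(ltr_pM2r t0); lra.
    by lra.
  have mE : m = n by apply/eqP; rewrite eqn_leq mn.
  by rewrite P// P'// -mE m3 m4.
by rewrite P// P'// => /andP[m1 m2]; exists n.
Qed.

Lemma marker_near_left a b e : fix_gap f a b -> 0 < e ->
  exists z, [/\ a < z, z < a + e, z < b & marker f z].
Proof.
move=> ab e0; have [aLb fa fb H] := ab.
have l0 : 0 < b - a by rewrite subr_gt0.
pose n := (Num.trunc ((b - a) / e)).+2.
have n2 : (2 <= n)%N by [].
have nR : 2 <= n%:R :> R by rewrite (ler_nat _ 2).
have ne : (b - a) / e < n%:R.
  by apply: (lt_trans (truncnS_gt _)); rewrite ltr_nat.
have n0 : 0 < n%:R :> R by lra.
have zb : a + (b - a) / n%:R < b.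
  by rewrite -ltrBrDl ltr_pdivrMr// -subr_gt0 -{2}[b - a]mulr1 -mulrBr mulr_gt0//; lra.
have az : a < a + (b - a) / n%:R by rewrite ltrDl divr_gt0.
exists (a + (b - a) / n%:R); split => //.
  by rewrite ltrD2l ltr_pdivrMr// mulrC -ltr_pdivrMr.
exists a, b, n; split => //; first by rewrite az zb.
  by rewrite addrAC subrr add0r mulrC mulfVK// gt_eqF.
rewrite [a + _ - a]addrAC subrr add0r mulrDl [n%:R * _]mulrC mulfVK ?gt_eqF// lerDl mulr_ge0//.
  by case: ifP => //; rewrite invr_ge0.
by rewrite divr_ge0// ltW.
Qed.

Lemma nonmarker_near_left a b e : fix_gap f a b -> 0 < e ->
  exists z, [/\ a < z, z < a + e & ~ markset f z].
Proof.
move=> ab e0; have [aLb fa fb H] := ab.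
have l0 : 0 < b - a by rewrite subr_gt0.
pose n := (Num.trunc ((b - a) / e)).+2.
have nR : 2 <= n%:R :> R by rewrite (ler_nat _ 2).
have ne : (b - a) / e < n%:R.
  by apply: (lt_trans (truncnS_gt _)); rewrite ltr_nat.
(* The ratio [n + 3/4] lies in no [[m, m + e]], since [e <= 1/2]. *)
set k : R := n%:R + 3 / 4.
have k0 : 0 < k by rewrite /k; lra.
set z := a + (b - a) / k.
have zb : z < b.
  rewrite /z -ltrBrDl ltr_pdivrMr// -subr_gt0 -{2}[b - a]mulr1 -mulrBr mulr_gt0//.
  by rewrite /k; lra.
have az : a < z by rewrite /z ltrDl divr_gt0.
exists z; split => //.
  rewrite ltrD2l ltr_pdivrMr// mulrC -ltr_pdivrMr//; apply: (lt_trans ne).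
  by rewrite /k; lra.
have zab : a < z < b by rewrite az zb.
rewrite nfix_markset; last exact: H.
rewrite (markerE ab zab) => -[m [m2 m3 m4]].
have t0 : 0 < z - a by rewrite subr_gt0.
have zE : b - a = k * (z - a) by rewrite /z addrAC subrr add0r mulrC mulfVK// gt_eqF.
move: m3 m4; rewrite zE !(ler_pM2r t0) /k => m3 m4.
have mn : (m <= n)%N.
  apply: (@nat_lt_frac _ _ (7 / 8) 0) => //; first by apply/andP; split; lra.
  by rewrite addr0; lra.
have nm : (n.+1 <= m)%N.
  apply: (@nat_lt_frac _ _ (7 / 8) 0) => //; first by apply/andP; split; lra.
  by rewrite -natr1; move: m4; case: ifP => _; lra.
by have := leq_trans nm mn; rewrite ltnn.
Qed.

(* Every gap starting at a fixed point has markers and non-markers arbitrarily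
   close to its left end. *)
Lemma fix_not_block s p : f p = p -> ~ block s (markset f) p.
Proof.
move=> fp [p0 [c [d [q0 [pc /andP[cp pd] dq _ H]]]]].
(* The last fixed point [e] of the supposed block is the left end of a gap. If [e < d], a non-marker
   close to [e] lies inside the block; if [e = d], a marker lies just outside it. *)
have [ed fe le] := last_fixP Hf d; set e := last_fix f d in ed fe le.
have pe : p <= e by exact: le.
have nofix z : e < z -> z < q0 -> f z <> z.
  move=> ez zq fz; have /H : p0 < z < q0 by rewrite zq andbT; lra.
  move=> [/(_ (or_introl fz)) /andP[_ zd] _].
  by have := le z zd fz; rewrite leNgt ez.
have eq0 : e < q0 by lra.
have xm : e < (e + q0) / 2 < q0 by apply/andP; split; lra.
have fx : f ((e + q0) / 2) <> (e + q0) / 2 by case/andP: xm => ? ?; exact: nofix.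
have gp := fix_gapP Hf fx.
have la : last_fix f ((e + q0) / 2) = e.
  have [l1 l2 l3] := last_fixP Hf ((e + q0) / 2).
  case/andP: xm => x1 x2.
  apply: le_anti; rewrite l3 ?(ltW x1)// andbT leNgt; apply/negP => lt.
  by apply: nofix l2; [exact: lt|exact: le_lt_trans x2].
rewrite la in gp.
have [ed'|de] := ltP e d.
  have e0 : 0 < Num.min (d - e) (q0 - e) by rewrite lt_min !subr_gt0 ed' eq0.
  have [z [z1 z2]] := nonmarker_near_left gp e0; apply.
  have /andP[zd zq] : (z - e < d - e) && (z - e < q0 - e) by rewrite -lt_min ltrBlDl.
  by apply/H; apply/andP; split; lra.
have q0e : 0 < q0 - e by lra.
have [z [z1 z2 _ mz]] := marker_near_left gp q0e.
have /H [/(_ (or_intror mz)) + _] : p0 < z < q0 by apply/andP; split; lra.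
by move=> /andP[]; lra.
Qed.

(** A fixed point between [u] and [x] would belong to [K] without being in a block, so [u] and [x]
    share a gap, and the block at [u] shows the sign of that gap. Conversely, any marker between the
    left end of the gap and [x] serves as [u]. *)
Lemma block_region_sign s x :
  block_region s (markset f) x <-> f x <> x /\ s = (x < f x).
Proof.
split=> [[u [ux Ku H]]|[fx ->]].
  have cux : conn (fixset f) u x.
    move=> z /orP[|/andP[xz zu]] => [uzx|] fz.
      by apply: (fix_not_block fz); apply: H => //; left.
    have zE : z = u by apply: le_anti; rewrite zu (le_trans ux xz).
    apply: (fix_not_block fz); apply: (H z); last by left.
    by rewrite zE lexx ux.
  have fu := conn_left cux.
  split; first exact: conn_right cux.
  rewrite -(conn_fix_sign Hf cux).
  have mu := (nfix_markset fu).1 Ku.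
  have b1 : block s (markset f) u by apply: H => //; rewrite lexx.
  have := marker_block mu; case: (u < f u) => b2; case: s b1 {H} => // b1.
    by have := block_excl b2 b1.
  by have := block_excl b1 b2.
have gp := fix_gapP Hf fx; have lx := last_fix_lt Hf fx.
have e0 : 0 < x - last_fix f x by rewrite subr_gt0.
have [z [z1 + z3 mz]] := marker_near_left gp e0.
rewrite addrC subrK => z2.
exists z; split; [exact: ltW|by right|].
move=> y /andP[zy yx] Ky.
have gy : last_fix f x < y < next_fix f x.
  by rewrite (lt_le_trans z1 zy) (le_lt_trans yx)// (next_fix_gt Hf).
have gx : last_fix f x < x < next_fix f x by rewrite lx (next_fix_gt Hf).
rewrite (gap_sign gp gx gy); apply: marker_block.
by apply/nfix_markset => //; case: gp => _ _ _; apply.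
Qed.

Lemma markset_closed : closed (markset f).
Proof.
rewrite -openC openE => x Kx.
suff [l [r [lx xr H]]] : exists l r, [/\ l < x, x < r & forall z, l < z < r -> ~ markset f z].
  rewrite /interior; near=> z; apply: H; apply/andP; split; near: z;
    [exact: lt_nbhsr|exact: lt_nbhsl].
have fx : f x <> x by move=> fx; apply: Kx; left.
have gp := fix_gapP Hf fx; have lx := last_fix_lt Hf fx; have xr := next_fix_gt Hf fx.
set a := last_fix f x in gp lx *; set b := next_fix f x in gp xr *.
have [ab fa fb H] := gp.
have xab : a < x < b by rewrite lx.
have t0 : 0 < x - a by rewrite subr_gt0.
have l0 : 0 < b - a by rewrite subr_gt0.
(* The ratio at [x] lies in [[n, n + 1[]. If [n >= 2] it even exceeds [n + e], as [x] is not a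
   marker, so ratios between [n + e] and [n + 1] give a free neighbourhood; if [n < 2], everything
   from ratio [n + 1] up to the end [b] is free. *)
have /andP[n1 n2] := truncn_itv (ltW (divr_gt0 l0 t0)).
set n := Num.trunc _ in n1 n2.
move: n1 n2; rewrite ler_pdivlMr// ltr_pdivrMr// => n1 n2.
have Kx' : ~ marker f x by move=> mx; apply: Kx; right.
set e := (if x < f x then 0 else 2^-1 : R).
have e0 : 0 <= e by rewrite /e; case: ifP => //; lra.
have P k z : 0 < k -> (a + (b - a) / k < z) = (b - a < k * (z - a)).
  by move=> k0; rewrite -ltrBrDl ltr_pdivrMr// mulrC.
have P' k z : 0 < k -> (z < a + (b - a) / k) = (k * (z - a) < b - a).
  by move=> k0; rewrite -ltrBlDl ltr_pdivlMr// mulrC.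
have n10 : 0 < n.+1%:R :> R by rewrite ltr0n.
have aux z m : a < z < b -> b - a < n.+1%:R * (z - a) ->
    m%:R * (z - a) <= b - a -> (m <= n)%N.
  move=> /andP[az _] h1 h2; rewrite -ltnS -(ltr_nat R).
  have z0 : 0 < z - a by rewrite subr_gt0.
  by rewrite -(ltr_pM2r z0); exact: le_lt_trans h1.
have al z : a + (b - a) / n.+1%:R < z -> a < z.
  by apply: lt_trans; rewrite ltrDl divr_gt0.
have [n2'|n1'] := leqP 2 n; last first.
  exists (a + (b - a) / n.+1%:R), b; split => //; first by rewrite P.
  move=> z /andP[z1 z2]; have az := al _ z1.
  have zab : a < z < b by rewrite az z2.
  rewrite nfix_markset; last exact: H.
  rewrite (markerE gp zab) => -[m [m2 m3 _]].
  rewrite P// in z1.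
  by have := aux _ _ zab z1 m3; rewrite leqNgt (leq_trans n1' m2).
have n2R : 2 <= n%:R :> R by rewrite (ler_nat _ 2).
have ne0 : 0 < n%:R + e by lra.
exists (a + (b - a) / n.+1%:R), (a + (b - a) / (n%:R + e)); split.
- by rewrite P.
- rewrite P'// ltNge; apply/negP => h; apply: Kx'.
  by apply/(markerE gp xab); exists n.
move=> z /andP[z1 z2]; have az := al _ z1.
have zb : z < b.
  apply: (lt_trans z2); rewrite -ltrBrDl ltr_pdivrMr// -subr_gt0.
  rewrite -{2}[b - a]mulr1 -mulrBr mulr_gt0//; lra.
have zab : a < z < b by rewrite az zb.
rewrite nfix_markset; last exact: H.
rewrite (markerE gp zab) => -[m [m2 m3]].
rewrite (gap_sign gp zab xab) -/e.
rewrite P// in z1; rewrite P'// in z2.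
have z0 : 0 < z - a by rewrite subr_gt0.
have mn := aux _ _ zab z1 m3.
move=> m4; have := lt_le_trans z2 m4; rewrite (ltr_pM2r z0) ltrD2r ltr_nat.
by rewrite ltnNge mn.
Unshelve. all: by end_near. Qed.

End single.

Lemma fix_gap_conj f1 f2 g gi a b : ac_auto g gi ->
  (forall x, f1 x = x <-> f2 (g x) = g x) ->
  fix_gap f1 a b -> fix_gap f2 (g a) (g b).
Proof.
move=> G fg [ab fa fb H]; split.
- by rewrite (ac_lt G).
- exact/fg.
- exact/fg.
- by move=> z; rewrite -(acKi G z) !(ac_lt G) => /H; rewrite fg.
Qed.

(** Markers are defined by the ratio [(b - a) / (x - a)], which affine maps preserve. Hence [g] is
    replaced in each gap by the affine map onto the image gap. *)
Lemma markset_conj f1 f1i f2 f2i g gi :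
  ac_auto f1 f1i -> ac_auto f2 f2i -> ac_auto g gi ->
  (forall x, (x < f1 x) = (g x < f2 (g x))) ->
  (forall x, f1 x = x <-> f2 (g x) = g x) ->
  exists h hi, ac_auto h hi /\ forall x, markset f1 x <-> markset f2 (h x).
Proof.
move=> H1 H2 G up fg.
pose A x := aff (last_fix f1 x) (next_fix f1 x) (g (last_fix f1 x)) (g (next_fix f1 x)).
pose Ai x := aff (g (last_fix f1 x)) (g (next_fix f1 x)) (last_fix f1 x) (next_fix f1 x).
pose h x := if f1 x == x then g x else A x x.
pose Z := fixset f1.
have ZP x : ~ Z x -> f1 x <> x by [].
have gap x : ~ Z x -> fix_gap f1 (last_fix f1 x) (next_fix f1 x) by exact: fix_gapP H1 _.
have ing x : ~ Z x -> last_fix f1 x < x < next_fix f1 x.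
  by move=> Zx; rewrite (last_fix_lt H1)// (next_fix_gt H1).
have lr x : ~ Z x -> last_fix f1 x < next_fix f1 x by move=> /gap[].
have glr x : ~ Z x -> g (last_fix f1 x) < g (next_fix f1 x).
  by move=> /gap[]; rewrite (ac_lt G).
have hA x : ~ Z x -> h x = A x x by rewrite /h; case: eqP.
have Alt x : ~ Z x -> {mono A x : y z / y < z}.
  by move=> Zx; apply: aff_lt; [exact: lr|exact: glr].
have AK x : ~ Z x -> cancel (A x) (Ai x).
  by move=> Zx; apply: affK; [exact: lr|exact: glr].
have AiK x : ~ Z x -> cancel (Ai x) (A x).
  by move=> Zx; apply: affK; [exact: glr|exact: lr].
have Al x : A x (last_fix f1 x) = g (last_fix f1 x) by exact: aff_left.
have Ar x : ~ Z x -> A x (next_fix f1 x) = g (next_fix f1 x).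
  by move=> Zx; apply: aff_right; exact: lr.
have cE x y : conn Z x y -> last_fix f1 y = last_fix f1 x /\ next_fix f1 y = next_fix f1 x.
  move=> xy; have Zx := conn_left xy.
  by apply: (fix_gap_last H1 (gap _ Zx)); apply: conn_fix_gap (gap _ Zx) (ing _ Zx) xy.
have AE x y : conn Z x y -> A y = A x by move=> /cE[]; rewrite /A => -> ->.
have AiE x y : conn Z x y -> Ai y = Ai x by move=> /cE[]; rewrite /Ai => -> ->.
have hin x : ~ Z x -> g (last_fix f1 x) < h x < g (next_fix f1 x).
  by move=> Zx; rewrite hA// -Al -Ar// !Alt// ing.
have hc x : ~ Z x -> conn Z x (gi (h x)).
  move=> Zx; apply: (fix_gap_conn (gap _ Zx)); first exact: ing.
  by rewrite -(ac_lt G) -(ac_lt G (gi _)) (acKi G) hin.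
have [||||||hi Hh] := @ac_glue _ g gi Z h rat (fun q => A (ratr q)) (fun q => Ai (ratr q)) G.
- by move=> x Zx; rewrite /h; case: eqP.
- by move=> x /(ac_out H1).
- move=> x y xy c; rewrite !hA; [|exact: conn_right c|exact: conn_left c].
  by rewrite (AE _ _ c) Alt//; exact: conn_left c.
- exact: hc.
- move=> x Zx; have c : conn Z x (Ai x (g x)).
    apply: (fix_gap_conn (gap _ Zx)); first exact: ing.
    by rewrite -(Alt _ Zx) -(Alt _ Zx (Ai _ _)) AiK// Al Ar// !(ac_lt G) ing.
  exists (Ai x (g x)) => //; rewrite hA; last exact: conn_right c.
  by rewrite (AE _ _ c) AiK.
(* The affine map depends on the gap only, so any rational point of the gap can index it. *)
- move=> x Zx; have [q] := rat_in_itvoo (lr _ Zx); rewrite in_itv/= => xq.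
  have c := fix_gap_conn (gap _ Zx) (ing _ Zx) xq.
  exists q; rewrite (AE _ _ c) (AiE _ _ c); split.
  + by apply: aff_lusin; [exact: lr|exact: glr].
  + by apply: aff_lusin; [exact: glr|exact: lr].
  + exact: hA.
  + by rewrite hA// AK.
exists h, hi; split => // x.
have [Zx|Zx] := pselect (Z x).
  have hx : h x = g x by rewrite /h; case: eqP.
  by split=> _; left => //; rewrite hx -fg.
have hx : f2 (h x) <> h x.
  by rewrite -(acKi G (h x)) -fg; exact: conn_right (hc _ Zx).
rewrite (nfix_markset Zx) (nfix_markset hx) (markerE (gap _ Zx) (ing _ Zx)).
rewrite (markerE (fix_gap_conj G fg (gap _ Zx)) (hin _ Zx)).
have -> : (h x < f2 (h x)) = (x < f1 x).
  by have := up (gi (h x)); rewrite (acKi G) => <-; rewrite (conn_fix_sign H1 (hc _ Zx)).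
set e := (if x < f1 x then 0 else 2^-1 : R).
rewrite hA// /A affE [X in X - g (last_fix f1 x)]addrC addrK.
set s := (g _ - g _) / _.
have s0 : 0 < s by rewrite divr_gt0// subr_gt0 ?lr ?glr.
have sE : g (next_fix f1 x) - g (last_fix f1 x) = (next_fix f1 x - last_fix f1 x) * s.
  by rewrite /s mulrC mulfVK// gt_eqF// subr_gt0 lr.
rewrite sE; split=> -[n [n2 h1 h2]]; exists n; split => //.
- by rewrite [leLHS]mulrA ler_pM2r.
- by rewrite [leRHS]mulrA ler_pM2r.
- by move: h1; rewrite [leLHS]mulrA ler_pM2r.
- by move: h2; rewrite [leRHS]mulrA ler_pM2r.
Qed.

End markers_theory.
(** * Borel maps into the Vietoris space *)

Section vietoris_borel.
Variable R : realType.
Implicit Types (t : I01 R) (q : rat * rat) (l : seq (rat * rat)).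

Definition rat_itv q : set (I01 R) := [set t | ratr q.1 < val t < ratr q.2].

Definition rat_union l : set (I01 R) := [set t | exists2 q, q \in l & rat_itv q t].

Lemma open_rat_itv q : open (rat_itv q).
Proof.
exists `]ratr q.1, ratr q.2[%classic; first exact: itv_open.
by apply/seteqP; split => t /=; rewrite in_itv.
Qed.

Lemma rat_ball (x e : R) : 0 < e -> exists q1 q2 : rat,
  ratr q1 < x < ratr q2 /\ forall y, ratr q1 < y < ratr q2 -> `|x - y| < e.
Proof.
move=> e0.
have lt1 : x - e < x by rewrite gtrBl.
have lt2 : x < x + e by rewrite ltrDl.
have [q1] := rat_in_itvoo lt1; have [q2] := rat_in_itvoo lt2.
rewrite !in_itv/= => /andP[a1 a2] /andP[b1 b2].
exists q1, q2; rewrite b2 a1; split => // y /andP[y1 y2].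
by rewrite ltr_norml; apply/andP; split; lra.
Qed.

Lemma rat_itv_base (O : set (I01 R)) t : open O -> O t ->
  exists2 q, rat_itv q t & rat_itv q `<=` O.
Proof.
move=> [V oV <-] Vt.
have : nbhs (set_val t) V by exact: open_nbhs_nbhs.
rewrite -nbhs_ballE => -[e /= e0 eV].
have [q1 [q2 [q12 H]]] := rat_ball (val t) e0.
by exists (q1, q2) => // s /H sE; exact/eV.
Qed.

Lemma compact_val (C : set (I01 R)) : closed C -> compact (val @` C).
Proof.
rewrite -openC => -[V oV VC].
have -> : val @` C = `[0, 1]%classic `&` ~` V.
  apply/seteqP; split => [_ [t Ct <-]|x [x01 Vx]].
    split; first by have := I01P t; rewrite /= in_itv.
    move=> Vt; have : (set_val @^-1` V) t by [].
    by rewrite VC.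
  rewrite /= in_itv/= in x01; exists (projI x); last by rewrite val_projI.
  apply: contrapT => Cx; have : (~` C) (projI x) by [].
  by rewrite -VC /= => h; apply: Vx; have := val_projI x01; move: h; rewrite /set_val => h' <-.
apply: compact_closedI; first exact: segment_compact.
exact: open_closedC.
Qed.

Lemma rat_union_between (C O : set (I01 R)) : closed C -> open O -> C `<=` O ->
  exists2 l, C `<=` rat_union l & rat_union l `<=` O.
Proof.
move=> cC oO CO.
have := compact_val cC; rewrite compact_cover.
move=> /(_ (rat * rat)%type [set q | rat_itv q `<=` O]
  (fun q => `]ratr q.1, ratr q.2[%classic)) [].
- by move=> q _; exact: itv_open.
- move=> _ [t Ct <-]; have [q qt qO] := rat_itv_base oO (CO _ Ct).
  by exists q => //=; rewrite in_itv.
move=> D DO CD; exists (finmap.enum_fset D).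
  move=> t Ct; have [q qD] := CD _ (imageP _ Ct).
  by rewrite /= in_itv => qt; exists q.
by move=> t [q qD qt]; have := DO q qD; rewrite inE; apply.
Qed.

(** Only countably many pairs [(l0, l1)] exist, so an open set becomes a countable union of
    conditions on finitely many rational intervals. *)
Lemma vietoris_base (W : set (closed_subsets (I01 R))) F : open W -> W F ->
  exists l0 l1, [/\ F `<=` rat_union l0,
    forall q, q \in l1 -> F `&` rat_itv q !=set0 &
    forall G : closed_subsets (I01 R), G `<=` rat_union l0 ->
      (forall q, q \in l1 -> G `&` rat_itv q !=set0) -> W G].
Proof.
move=> [D' sD' <-] [A D'A AF].
have [E sE EA] := sD' _ D'A.
(* Induction over the members of a finite intersection: inclusions are merged into one open set [U],
   and each hitting condition is shrunk to a rational interval. *)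
have : forall s : seq (set (closed_subsets (I01 R))),
    (forall V, V \in s -> vietoris_subbase V) -> (forall V, V \in s -> V F) ->
    exists U l1, [/\ open U, F `<=` U,
      forall q, q \in l1 -> F `&` rat_itv q !=set0 &
      forall G : closed_subsets (I01 R), G `<=` U ->
        (forall q, q \in l1 -> G `&` rat_itv q !=set0) -> forall V, V \in s -> V G].
  elim=> [|V s IH] sb sF.
    by exists setT, [::]; split => //; exact: openT.
  have [||U [l1 [oU FU Fl1 UG]]] := IH.
  - by move=> V' V's; apply: sb; rewrite inE V's orbT.
  - by move=> V' V's; apply: sF; rewrite inE V's orbT.
  have VF : V F by apply: sF; rewrite inE eqxx.
  have : vietoris_subbase V by apply: sb; rewrite inE eqxx.
  case=> -[Q oQ QV]; move: VF; rewrite -QV.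
  - move=> FQ; exists (U `&` Q), l1; split => //; first exact: openI.
      by move=> t Ft; split; [exact: FU|exact: FQ].
    move=> G GUQ Gl V'; rewrite inE => /orP[/eqP ->|]; first by move=> t /GUQ[].
    by apply: UG => // t /GUQ[].
  - move=> [t [Ft Qt]]; have [q qt qQ] := rat_itv_base oQ Qt.
    exists U, (q :: l1); split => //.
      by move=> q'; rewrite inE => /orP[/eqP ->|/Fl1//]; exists t.
    move=> G GU Gl V'; rewrite inE => /orP[/eqP ->|]; last first.
      by apply: UG => // q' q'l; apply: Gl; rewrite inE q'l orbT.
    have [|s' [Gs qs]] := Gl q; first by rewrite inE eqxx.
    by exists s'; split => //; exact: qQ.
move=> /(_ (finmap.enum_fset E))[].
- by move=> V /sE; rewrite inE.
- by move=> V VE; move: AF; rewrite /= -EA; apply.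
move=> U [l1 [oU FU Fl UG]].
have [l0 Fl0 l0U] := rat_union_between (@closed_setP _ F) oU FU.
exists l0, l1; split => // G Gl0 Gl1; exists A => //.
rewrite -EA /= => V VE; apply: UG VE => //.
exact: subset_trans l0U.
Qed.

Lemma measurable_forall_seq d (T : measurableType d) (I : eqType)
    (P : I -> set T) (l : seq I) : (forall i, measurable (P i)) ->
  measurable [set x | forall i, i \in l -> P i x].
Proof.
move=> mP; elim: l => [|i l IH].
  by rewrite (_ : [set _ | _] = setT)//; apply/seteqP; split.
rewrite (_ : [set _ | _] = P i `&` [set x | forall i, i \in l -> P i x]).
  exact: measurableI.
apply/seteqP; split => x /=.
  by move=> H; split => [|j jl]; apply: H; rewrite inE ?eqxx ?jl ?orbT.
by move=> [Pi H] j; rewrite inE => /orP[/eqP ->|/H].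
Qed.

(** Hitting conditions alone suffice: by compactness [f x] lies in an open set iff it misses
    finitely many rational intervals covering the complement of that set. *)
Lemma measurable_closed_subsets (X : ptopologicalType)
    (f : X -> closed_subsets (I01 R)) :
  (forall q, (@measurable _ (borel X)) [set x | f x `&` rat_itv q !=set0]) ->
  measurable_fun setT (f : borel X -> borel (closed_subsets (I01 R))).
Proof.
move=> mf; apply: (@measurability _ _ (borel X) (borel (closed_subsets (I01 R))) setT f
  (@open (closed_subsets (I01 R)))) => //.
move=> _ [W oW <-]; rewrite setTI.
pose N (i : seq (rat * rat) * seq (rat * rat)) : set (borel X) :=
  if `[< forall G : closed_subsets (I01 R), G `<=` rat_union i.1 ->
      (forall q, q \in i.2 -> G `&` rat_itv q !=set0) -> W G >]
  then [set x | f x `<=` rat_union i.1] `&`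
    [set x | forall q, q \in i.2 -> f x `&` rat_itv q !=set0]
  else set0.
have -> : f @^-1` W = \bigcup_i N i.
  apply/seteqP; split => x /=.
    move=> Wfx; have [l0 [l1 [H0 H1 H2]]] := vietoris_base oW Wfx.
    by exists (l0, l1) => //; rewrite /N; case: asboolP.
  by move=> [i _]; rewrite /N; case: asboolP => // H [] /H; apply.
apply: countable_bigcupT_measurable; first exact: countableP.
move=> i; rewrite /N; case: asboolP => _; last exact: measurable0.
apply: measurableI; last exact: (@measurable_forall_seq _ (borel X) _
  (fun q => [set x | f x `&` rat_itv q !=set0])).
pose M l : set (borel X) := if `[< ~` rat_union i.1 `<=` rat_union l >]
  then [set x | forall q, q \in l -> (~` [set x | f x `&` rat_itv q !=set0]) x] else set0.
have -> : [set x | f x `<=` rat_union i.1] = \bigcup_l M l.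
  apply/seteqP; split => x /=.
    move=> fx; have [|||l l1 l2] := @rat_union_between (~` rat_union i.1) (~` f x).
    - rewrite closedC; have -> : rat_union i.1 = \bigcup_(q in [set q | q \in i.1]) rat_itv q.
        by apply/seteqP; split => t [q ? ?]; exists q.
      by apply: bigcup_open => q _; exact: open_rat_itv.
    - by rewrite openC; exact: closed_setP.
    - by apply: subsetC.
    exists l => //; rewrite /M; case: asboolP => // _ q ql [t [ft qt]].
    by apply: (l2 t) => //; exists q.
  move=> [l _]; rewrite /M; case: asboolP => // lH fl t ft.
  apply: contrapT => /lH [q ql qt]; apply: (fl q ql); by exists t.
apply: countable_bigcupT_measurable; first exact: countableP.
move=> l; rewrite /M; case: asboolP => _; last exact: measurable0.
apply: measurable_forall_seq => q; exact: measurableC.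
Qed.

End vietoris_borel.
(** * From conjugacy to closed sets *)

Section conjugacy_to_sets.
Variable R : realType.
Implicit Types (f g : AC01 R) (F : closed_subsets (I01 R)).

Lemma E_CP f1 f2 : E_C f1 f2 <->
  exists h hi, ac_auto h hi /\ forall x, h (ext f1 x) = ext f2 (h x).
Proof.
split=> [[g gf]|[h [hi [H hf]]]].
  exists (ext g), (ext (homeo_inv g)); split; first exact: ext_auto.
  move=> x; have [x01|xN] := boolP (0 <= x <= 1).
    rewrite -(val_projI x01) !ext_val -gf; congr (val (g (f1 _))).
    by rewrite homeo_funK.
  have E k : ext k x = x by rewrite /ext (negPf xN).
  by rewrite !E.
have [g [gE giE]] := ac_autoP H.
exists g => t; apply/val_inj.
rewrite -!ext_val gE giE hf (acKi H).
by rewrite ext_val.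
Qed.

Lemma E_HP F1 F2 : E_H F1 F2 <->
  exists h hi, ac_auto h hi /\
    forall x, (val @` (F1 : set _)) x <-> (val @` (F2 : set _)) (h x).
Proof.
split=> [[g gF]|[h [hi [H hF]]]].
  exists (ext g), (ext (homeo_inv g)); have G := ext_auto g; split => //.
  move=> x; split=> [[t F1t <-]|].
    by exists (g t); [rewrite -gF; exists t|rewrite ext_val].
  rewrite -gF => -[_ [t F1t <-]]; rewrite -ext_val => /(can_inj (acK G)) <-.
  by exists t.
have [g [gE giE]] := ac_autoP H.
exists g; apply/seteqP; split => [_ [t F1t <-]|s F2s].
  have := (hF (val t)).1 (imageP _ F1t); rewrite -gE ext_val.
  by move=> [s F2s /val_inj <-].
have := hF (hi (val s)); rewrite (acKi H) => -[_ /(_ (imageP _ F2s))].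
rewrite -giE ext_val => -[t F1t /val_inj tE].
by exists t => //; rewrite tE homeo_invK.
Qed.

Lemma closed_marked f : closed [set t : I01 R | markset (ext f) (val t)].
Proof.
have mc := markset_closed (ext_auto f).
rewrite -openC; exists (~` markset (ext f)); first by rewrite openC.
by apply/seteqP; split.
Qed.

Definition marked f : closed_subsets (I01 R) := ClosedSubset (@closed_marked f).

Lemma val_marked f x : (val @` (marked f : set _)) x <-> 0 <= x <= 1 /\ markset (ext f) x.
Proof.
split=> [[t ft <-]|[x01 fx]]; first by rewrite I01P.
by exists (projI x); [move: fx; rewrite -{1}(val_projI x01)|exact: val_projI].
Qed.

Lemma markset_outside f x : ~~ (0 <= x <= 1) -> markset (ext f) x.
Proof. by move=> xN; left; rewrite /ext (negPf xN). Qed.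

(** Every point outside [[0, 1]] is fixed, hence in [markset], so the condition may be tested on the
    whole line. *)
Lemma E_H_marked f1 f2 : E_H (marked f1) (marked f2) <->
  exists h hi, ac_auto h hi /\
    forall x, markset (ext f1) x <-> markset (ext f2) (h x).
Proof.
rewrite E_HP; split=> -[h [hi [H hF]]]; exists h, hi; split => // x.
  have [x01|xN] := boolP (0 <= x <= 1).
    have := hF x; rewrite !val_marked x01 (ac_in_cc H x01).
    by move=> [a b]; split=> m; [apply a|apply b].
  split=> _; apply: markset_outside => //; apply: contra xN => hx.
  by rewrite -(acK H x) (ac_in_cc (ac_inv H)).
rewrite !val_marked hF; split=> -[x01 ?]; split => //; first exact: (ac_in_cc H).
by rewrite -(acK H x) (ac_in_cc (ac_inv H)).
Qed.

(** Backwards, a map [h] between the marked sets preserves [block_region], hence the signs, and so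
    qualifies as the [g] of [conj_ac_auto]. *)
Lemma E_C_marked f1 f2 : E_C f1 f2 <-> E_H (marked f1) (marked f2).
Proof.
have H1 := ext_auto f1; have H2 := ext_auto f2.
rewrite E_CP E_H_marked; split=> -[h [hi [H hf]]].
  apply: (markset_conj H1 H2 H) => x; first by rewrite -hf (ac_lt H).
  by rewrite -hf; split=> [->//|/(can_inj (acK H))].
have reg s x : block_region s (markset (ext f1)) x <-> block_region s (markset (ext f2)) (h x).
  split; first exact: (block_region_mono H hf).
  rewrite -{2}(acK H x); apply: (block_region_mono (ac_inv H)) => z.
  by rewrite hf (acKi H).
apply: (conj_ac_auto H1 H2 H) => x.
- have := reg true x; rewrite (block_region_sign H1) (block_region_sign H2) => -[a b].
  apply/idP/idP => lt.
    have [|_ <-//] := a _; split; last by rewrite lt.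
    by move=> E; rewrite E ltxx in lt.
  have [|_ <-//] := b _; split; last by rewrite lt.
  by move=> E; rewrite E ltxx in lt.
- have := reg false x; rewrite (block_region_sign H1) (block_region_sign H2) => -[a b].
  have aux (k : R -> R) z : k z < z <-> k z <> z /\ false = (z < k z).
    split=> [lt|[kz /esym/negbT]]; last by rewrite -leNgt le_eqVlt => /orP[/eqP|].
    by split; [move=> E; rewrite E ltxx in lt|rewrite ltNge (ltW lt)].
  by apply/idP/idP => /aux lt; apply/aux; [exact: a|exact: b].
Qed.

(** The integral in [dAC] is nonnegative, so [dAC] dominates the uniform distance. *)
Lemma dAC_sup f g (e : R) : dAC f g < e -> forall x, `|ext f x - ext g x| < e.
Proof.
move=> fge x; apply: le_lt_trans fge; rewrite /dAC -[leLHS]addr0.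
apply: lerD; last by apply: Rintegral_ge0.
pose S := range (fun t : I01 R => `|val (f t) - val (g t)|).
have ubS : has_ubound S.
  exists 1 => _ [t _ <-]; have := I01P (f t); have := I01P (g t).
  by rewrite ler_norml => /andP[? ?] /andP[? ?]; apply/andP; split; lra.
have [x01|xN] := boolP (0 <= x <= 1).
  rewrite -(val_projI x01) !ext_val; apply: (ub_le_sup ubS).
  by exists (projI x).
rewrite /ext (negPf xN) subrr normr0.
by apply: le_trans (ub_le_sup ubS (imageP _ (I : setT (projI 0)))).
Qed.

Lemma open_dAC (U : set (AC01 R)) : dAC_open U -> open U.
Proof. by []. Qed.

(** The minimum of [|f x - x|] over the compact interval serves as radius. *)
Lemma open_no_fix (p q : R) : open [set f : AC01 R | forall x, p <= x <= q -> ext f x <> x].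
Proof.
apply: open_dAC => f fpq; have [pq|qp] := leP p q; last first.
  exists 1 => // g _ x /andP[px xq].
  by have := lt_le_trans qp (le_trans px xq); rewrite ltxx.
have cf : {within `[p, q], continuous (fun x => `|ext f x - x|)}.
  apply: continuous_subspaceT => x; apply: cvg_norm; apply: cvgB; last exact: cvg_id.
  exact: (ac_continuous (ext_auto f)).
have [c + cmin] := EVT_min pq cf; rewrite in_itv/= => cpq.
exists `|ext f c - c|; first by rewrite normr_gt0 subr_eq0; apply/eqP/fpq.
move=> g /dAC_sup fg x xpq gx.
have := cmin x; rewrite in_itv/= => /(_ xpq); apply/negP; rewrite -ltNge.
by have := fg x; rewrite gx.
Qed.

Lemma open_up r : open [set f : AC01 R | r < ext f r].
Proof.
apply: open_dAC => f fr; exists (ext f r - r); first by rewrite subr_gt0.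
by move=> g /dAC_sup/(_ r); rewrite ltr_norml => /andP[_]; rewrite ltrD2l ltrN2.
Qed.

Lemma open_down r : open [set f : AC01 R | ext f r < r].
Proof.
apply: open_dAC => f fr; exists (r - ext f r); first by rewrite subr_gt0.
move=> g /dAC_sup/(_ r); rewrite ltr_norml => /andP[+ _] /=; lra.
Qed.

Lemma measurable_open (X : ptopologicalType) (U : set X) : open U ->
  (@measurable _ (borel X)) U.
Proof. by move=> oU; exact: sub_sigma_algebra. Qed.

(** For [s <= r], [last_fix < s] means that [[s, r]] contains no fixed point, an open condition: the
    function is upper semicontinuous. *)
Lemma measurable_last_fix r :
  measurable_fun setT (fun f : borel (AC01 R) => last_fix (ext f) r).
Proof.
apply: (measurability _ (RGenInftyO.measurableE R)).
move=> _ [_ [s ->] <-]; rewrite setTI.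
apply: measurable_open.
have [sr|rs] := leP s r.
  have -> : (fun f : AC01 R => last_fix (ext f) r) @^-1` `]-oo, s[%classic =
    [set f : AC01 R | forall x, s <= x <= r -> ext f x <> x].
    apply/seteqP; split => f /=; rewrite in_itv/=; have [l1 l2 l3] := last_fixP (ext_auto f) r.
      move=> ls x /andP[sx xr] fx; have := l3 _ xr fx.
      by rewrite leNgt (lt_le_trans ls sx).
    by move=> H; rewrite ltNge; apply/negP => sl; apply: H l2; rewrite sl.
  exact: open_no_fix.
have -> : (fun f : AC01 R => last_fix (ext f) r) @^-1` `]-oo, s[%classic = setT.
  apply/seteqP; split => f //= _; rewrite in_itv/=.
  by have [/le_lt_trans + _ _] := last_fixP (ext_auto f) r; apply.
exact: openT.
Qed.

Lemma measurable_next_fix r :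
  measurable_fun setT (fun f : borel (AC01 R) => next_fix (ext f) r).
Proof.
apply: (measurability _ (RGenOInfty.measurableE R)).
move=> _ [_ [s ->] <-]; rewrite setTI.
apply: measurable_open.
have [rs|sr] := leP r s.
  have -> : (fun f : AC01 R => next_fix (ext f) r) @^-1` `]s, +oo[%classic =
    [set f : AC01 R | forall x, r <= x <= s -> ext f x <> x].
    apply/seteqP; split => f /=; rewrite in_itv/= andbT;
      have [l1 l2 l3] := next_fixP (ext_auto f) r.
      move=> ls x /andP[rx xs] fx; have := l3 _ rx fx.
      by rewrite leNgt (le_lt_trans xs ls).
    by move=> H; rewrite ltNge; apply/negP => sl; apply: H l2; rewrite sl andbT.
  exact: open_no_fix.
have -> : (fun f : AC01 R => next_fix (ext f) r) @^-1` `]s, +oo[%classic = setT.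
  apply/seteqP; split => f //= _; rewrite in_itv/= andbT.
  by have [/(lt_le_trans _) + _ _] := next_fixP (ext_auto f) r; apply.
exact: openT.
Qed.

End conjugacy_to_sets.

(** * Borel measurability of the marked set *)

Section marked_borel.
Variable R : realType.
Local Notation AC := (borel (AC01 R)).

Lemma measurable_lt (F : AC -> R) (c : R) : measurable_fun setT F ->
  measurable [set f | F f < c].
Proof.
move=> mF; have := mF measurableT `]-oo, c[%classic (measurable_itv _).
by rewrite setTI; congr (measurable _); apply/seteqP; split => f /=; rewrite in_itv.
Qed.

Lemma measurable_gt (F : AC -> R) (c : R) : measurable_fun setT F ->
  measurable [set f | c < F f].
Proof.
move=> mF; have := mF measurableT `]c, +oo[%classic (measurable_itv _).
by rewrite setTI; congr (measurable _); apply/seteqP; split => f /=; rewrite in_itv/= andbT.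
Qed.

Lemma measurable_gap_point r (k : R) : measurable_fun setT (fun f : AC =>
  last_fix (ext f) r + (next_fix (ext f) r - last_fix (ext f) r) * k).
Proof.
apply: measurable_funD; first exact: measurable_last_fix.
apply: measurable_funM; last exact: measurable_cst.
by apply: measurable_funB; [exact: measurable_next_fix|exact: measurable_last_fix].
Qed.

Lemma itv_meet (c d p q : R) : c <= d -> p < q -> c < q -> p < d ->
  exists x, [/\ c <= x, x <= d, p < x & x < q].
Proof.
move=> cd pq cq pd; have [pc|cp] := ltP p c; first by exists c; split.
have [dq|qd] := ltP d q; first by exists d; split.
by exists ((p + q) / 2); split; lra.
Qed.

(** A marked point in the interval is either a fixed point in a rational closed subinterval ([A1])
    or a point of the [n]-th marker of a gap containing a rational [r] ([A2]). The marker is a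
    closed interval, possibly a point, so meeting []p1, p2[] amounts to two inequalities on its
    ends. *)
Lemma measurable_hit_marked (q : rat * rat) :
  (@measurable _ AC) [set f | (marked f : set _) `&` rat_itv q !=set0].
Proof.
pose p1 : R := ratr q.1; pose p2 : R := ratr q.2.
have [p21|p12] := leP p2 p1.
  rewrite (_ : [set _ | _] = set0); first exact: measurable0.
  apply/seteqP; split => // f [t [_ /andP[t1 t2]]].
  by have := lt_le_trans (lt_trans t1 t2) p21; rewrite ltxx.
(* Truncating at 0 and 1 discards the fixed points that [ext f] has outside [[0, 1]]. *)
pose A1 (i : rat * rat) : set AC :=
  if (p1 < ratr i.1) && (ratr i.2 < p2) then
    ~` [set f | forall x, Num.max (ratr i.1) 0 <= x <= Num.min (ratr i.2) 1 -> ext f x <> x]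
  else set0.
pose M (s : bool) (r : rat) (n : nat) : set AC :=
  let e : R := if s then 0 else 2^-1 in
  let P k (f : AC) := last_fix (ext f) (ratr r) +
      (next_fix (ext f) (ratr r) - last_fix (ext f) (ratr r)) * k in
  if (2 <= n)%N then
  (if s then [set f : AC | ratr r < ext f (ratr r)] else [set f : AC | ext f (ratr r) < ratr r])
  `&` ([set f : AC | P (n%:R + e)^-1 f < p2] `&` [set f : AC | p1 < P n%:R^-1 f])
  else set0.
pose A2 (i : bool * rat * nat) : set AC := M i.1.1 i.1.2 i.2.
have mA1 i : measurable (A1 i).
  rewrite /A1; case: ifP => _; last exact: measurable0.
  apply: measurableC; apply: measurable_open; exact: open_no_fix.
have mA2 i : measurable (A2 i).
  rewrite /A2 /M; case: ifP => _; last exact: measurable0.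
  apply: measurableI; last first.
    by apply: measurableI; [apply: measurable_lt|apply: measurable_gt]; exact: measurable_gap_point.
  case: ifP => _; apply: measurable_open; [exact: open_up|exact: open_down].
have mU : measurable ((\bigcup_i A1 i) `|` (\bigcup_i A2 i)).
  by apply: measurableU; apply: countable_bigcupT_measurable => //; exact: countableP.
congr (measurable _) : mU; apply/seteqP; split => f.
  move=> [[i _]|[[[s r] n] _]].
    rewrite /A1; case: ifP => // /andP[i1 i2] /existsNP[x] /not_implyP[].
    rewrite le_min ge_max => /andP[/andP[x1 x0] /andP[x2 x1']] /contrapT fx.
    have x01 : 0 <= x <= 1 by rewrite x0.
    exists (projI x); split; first by rewrite /= -[Num.max _ _]/(val (projI x)) val_projI//; left.
    rewrite /rat_itv /= -[Num.max _ _]/(val (projI x)) val_projI//.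
    by rewrite (lt_le_trans i1 x1) (le_lt_trans x2 i2).
  rewrite /A2 /M /=; case: ifP => // n2 [sf [c2 d1]].
  have H := ext_auto f.
  have fr : ext f (ratr r) <> ratr r.
    by case: s sf {c2} => /= + E; rewrite E ltxx.
  have gp := fix_gapP H fr.
  have gr : last_fix (ext f) (ratr r) < ratr r < next_fix (ext f) (ratr r).
    by rewrite (last_fix_lt H)// (next_fix_gt H).
  move: c2 d1; set a := last_fix _ _ in gp gr *; set b := next_fix _ _ in gp gr *.
  set e : R := if s then 0 else 2^-1.
  have sE : (if (ratr r : R) < ext f (ratr r) then 0 else 2^-1 : R) = e.
    by rewrite /e; case: s sf {e} => /= [->//|]; case: ltgtP.
  have [ab fa fb nofix] := gp.
  have e0 : 0 <= e by rewrite /e; case: s {sf sE e} => //; rewrite invr_ge0.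
  have nR : 2 <= n%:R :> R by rewrite (ler_nat _ 2).
  have k1 : 0 < n%:R + e by lra.
  have k2 : 0 < n%:R :> R by lra.
  have l0 : 0 < b - a by rewrite subr_gt0.
  move=> c2 d1.
  have cd : a + (b - a) * (n%:R + e)^-1 <= a + (b - a) * n%:R^-1.
    by rewrite lerD2l ler_pM2l// lef_pV2 ?posrE//; lra.
  have [x [x1 x2 x3 x4]] := itv_meet cd p12 c2 d1.
  have ax : a < x by apply: lt_le_trans x1; rewrite ltrDl divr_gt0.
  have xb : x < b.
    apply: (le_lt_trans x2).
    rewrite -ltrBrDl ltr_pdivrMr// -subr_gt0 -{2}[b - a]mulr1 -mulrBr mulr_gt0//; lra.
  have xab : a < x < b by rewrite ax xb.
  have x01 : 0 <= x <= 1.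
    have : ~~ ~~ (0 < x < 1) by apply/negP => /(ac_out H); exact: nofix.
    by rewrite negbK => /andP[? ?]; rewrite !ltW.
  exists (projI x); split; last first.
    by rewrite /rat_itv /= -[Num.max _ _]/(val (projI x)) val_projI// x3 x4.
  rewrite /= -[Num.max _ _]/(val (projI x)) val_projI//; right.
  apply/(markerE gp xab); exists n; split => //.
    by rewrite mulrC -ler_pdivlMr// lerBlDl.
  by rewrite (gap_sign H gp xab gr) sE mulrC -ler_pdivrMr// lerBrDl.
move=> [t [ft /andP[t1 t2]]]; have H := ext_auto f.
have /andP[t0 t1'] := I01P t.
case: ft => [ft|[a [b [n [gp xab n2 h1 h2]]]]].
  left; have [r1] := rat_in_itvoo t1; have [r2] := rat_in_itvoo t2.
  rewrite !in_itv/= => /andP[r21 r22] /andP[r11 r12].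
  exists (r1, r2) => //; rewrite /A1 /= r11 r22/= => /(_ (val t)); apply => //.
  by rewrite le_min ge_max t0 t1' !ltW.
right; have [ab fa fb nofix] := gp; have [r] := rat_in_itvoo ab.
rewrite in_itv/= => gr.
have [lE nE] := fix_gap_last H gp gr.
exists (((val t < ext f (val t)), r), n) => //; rewrite /A2 /M /= n2.
have nR : 2 <= n%:R :> R by rewrite (ler_nat _ 2).
have e0 : 0 <= (if val t < ext f (val t) then 0 else 2^-1 : R) by case: ifP => //; rewrite invr_ge0.
have k2 : 0 < n%:R :> R by lra.
split.
  have := gap_sign H gp gr xab; case: ifP => tf /=; first by move=> ->.
  move=> /negbT; rewrite -leNgt le_eqVlt => /orP[/eqP rE|//].
  by have := nofix _ gr; rewrite rE.
split; rewrite /= lE nE.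
  by apply: le_lt_trans t2; rewrite -lerBrDl ler_pdivrMr 1?mulrC// ltr_wpDr.
by apply: (lt_le_trans t1); rewrite -lerBlDl ler_pdivlMr// mulrC.
Qed.

Lemma E_C_reducible_E_H : borel_reducible (@E_C R) (@E_H R).
Proof.
exists (@marked R); last exact: E_C_marked.
by apply: measurable_closed_subsets => q; exact: measurable_hit_marked.
Qed.

End marked_borel.
(** * From closed sets to conjugacy *)

Section weighted_series.
Variable R : realType.
Implicit Types (u v : nat -> R) (M : R).

(** The weights sum to 1, so a bound on the terms is a bound on the sum. *)
Definition wsum u : R := limn (series (fun n => u n * 2^-1 ^+ n.+1)).

Definition wbounded u := exists M, forall n, `|u n| <= M.

Let half_norm : `|2^-1 : R| < 1.
Proof. by rewrite ger0_norm ?invr_ge0// invf_lt1// ltr1n. Qed.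

Lemma wsum_normed_cvg u : wbounded u ->
  cvgn [normed series (fun n => u n * 2^-1 ^+ n.+1)].
Proof.
move=> [M uM]; have M0 : 0 <= M by exact: le_trans (normr_ge0 _) (uM 0%N).
apply: (@series_le_cvg _ _ (geometric (M / 2) 2^-1)) => [n|n|n|].
- exact: normr_ge0.
- by rewrite /= mulr_ge0 ?exprn_ge0 ?divr_ge0 ?invr_ge0.
- rewrite /= normrM (ger0_norm (exprn_ge0 _ _)) ?invr_ge0// exprS mulrA.
  by rewrite ler_wpM2r ?exprn_ge0 ?invr_ge0// ler_wpM2r ?invr_ge0.
- exact: is_cvg_geometric_series.
Qed.

Lemma wsum_cvg u : wbounded u -> cvgn (series (fun n => u n * 2^-1 ^+ n.+1)).
Proof. by move=> /wsum_normed_cvg/normed_cvg. Qed.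

Lemma wsum_tail u M N : (forall n, (n < N)%N -> u n = 0) ->
  (forall n, `|u n| <= M) -> `|wsum u| <= M * 2^-1 ^+ N.
Proof.
move=> u0 uM; have M0 : 0 <= M by exact: le_trans (normr_ge0 _) (uM 0%N).
have ub : wbounded u by exists M.
apply: le_trans (lim_series_norm (wsum_normed_cvg ub)) _.
apply: limr_le; first exact: wsum_normed_cvg.
apply: nearW => n.
suff : \sum_(0 <= k < n) `|u k * 2^-1 ^+ k.+1| + M * 2^-1 ^+ (maxn n N) <= M * 2^-1 ^+ N.
  by apply: le_trans; rewrite lerDl mulr_ge0// exprn_ge0// invr_ge0.
elim: n => [|n IH]; first by rewrite big_geq// add0r max0n.
apply: le_trans IH; rewrite big_nat_recr//= -addrA lerD2l.
have [nN|Nn] := ltnP n N.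
  by rewrite u0// mul0r normr0 add0r (maxn_idPr nN) ?(maxn_idPr (ltnW nN)).
rewrite (maxn_idPl (leqW Nn)) ?(maxn_idPl Nn).
rewrite normrM (ger0_norm (exprn_ge0 _ _)) ?invr_ge0//.
have := uM n; have p0 : 0 <= 2^-1 ^+ n.+1 :> R by rewrite exprn_ge0 ?invr_ge0.
move=> /(ler_wpM2r p0) h; apply: le_trans (lerD h (lexx _)) _.
by rewrite exprS -mulr2n; lra.
Qed.

Lemma wsum_le u M : (forall n, `|u n| <= M) -> `|wsum u| <= M.
Proof. by move=> uM; apply: le_trans (@wsum_tail u M 0%N _ uM) _; rewrite ?mulr1. Qed.

Lemma wboundedD u v : wbounded u -> wbounded v -> wbounded (fun n => u n + v n).
Proof.
move=> [M uM] [M' vM]; exists (M + M') => n.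
by apply: le_trans (ler_normD _ _) _; exact: lerD.
Qed.

Lemma wboundedZ (a : R) u : wbounded u -> wbounded (fun n => a * u n).
Proof.
by move=> [M uM]; exists (`|a| * M) => n; rewrite normrM ler_wpM2l.
Qed.

Lemma wsumD u v : wbounded u -> wbounded v ->
  wsum (fun n => u n + v n) = wsum u + wsum v.
Proof.
move=> ub vb; rewrite /wsum -lim_seriesD; [|exact: wsum_cvg..].
by congr (limn (series _)); apply/funext => n; rewrite mulrDl.
Qed.

Lemma wsumZ (a : R) u : wbounded u -> wsum (fun n => a * u n) = a * wsum u.
Proof.
move=> ub; have -> : a * wsum u = a *: wsum u by [].
rewrite /wsum -lim_seriesZ; last exact: wsum_cvg.
by congr (limn (series _)); apply/funext => n; rewrite -mulrA.
Qed.

Lemma wsumB u v : wbounded u -> wbounded v ->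
  wsum (fun n => u n - v n) = wsum u - wsum v.
Proof.
move=> ub vb; have := wsumD ub (wboundedZ (-1) vb).
rewrite wsumZ// mulN1r => <-.
by congr wsum; apply/funext => n; rewrite mulN1r.
Qed.

Lemma wsum_gt0 u k : wbounded u -> (forall n, 0 <= u n) -> 0 < u k -> 0 < wsum u.
Proof.
move=> ub u0 uk.
have w0 n : 0 <= u n * 2^-1 ^+ n.+1 by rewrite mulr_ge0// exprn_ge0 ?invr_ge0.
have nd : nondecreasing_seq (series (fun n => u n * 2^-1 ^+ n.+1)).
  by apply: nondecreasing_series => n _ _; exact: w0.
apply: lt_le_trans (nondecreasing_cvgn_le nd (wsum_cvg ub) k.+1).
rewrite seriesSr ltr_wpDl ?mulr_gt0 ?exprn_gt0 ?invr_gt0//.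
by apply: sumr_ge0 => n _.
Qed.

End weighted_series.

(** * Bump functions and their Taylor estimate *)

Section bumps.
Variable R : realType.
Implicit Types (p q x y : R).

Definition tent p q x := Num.max 0 ((x - p) * (q - x)).
Definition bump p q x := tent p q x ^+ 2.
(** The derivative of [bump]; squaring [tent] has removed its corners at [p] and [q]. *)
Definition dbump p q x := 2 * tent p q x * (p + q - 2 * x).

Lemma tent_ge0 p q x : 0 <= tent p q x.
Proof. by rewrite le_max lexx. Qed.

Lemma tent_in p q x : p <= x <= q -> tent p q x = (x - p) * (q - x).
Proof. by move=> /andP[px xq]; apply: max_r; rewrite mulr_ge0// subr_ge0. Qed.

Lemma tent_out p q x : p <= q -> ~~ (p < x < q) -> tent p q x = 0.
Proof.
move=> pq; rewrite negb_and -!leNgt => /orP[xp|qx]; apply: max_l.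
  by rewrite mulr_le0_ge0 ?subr_le0 ?subr_ge0// (le_trans xp).
by rewrite mulr_ge0_le0 ?subr_le0 ?subr_ge0// (le_trans pq).
Qed.

Lemma tent_gt0 p q x : p <= q -> (0 < tent p q x) = (p < x < q).
Proof.
move=> pq; apply/idP/idP => [|/andP[px xq]].
  by apply: contraTT => /(tent_out pq) ->; rewrite ltxx.
by rewrite tent_in ?ltW// ?mulr_gt0 ?subr_gt0.
Qed.

Lemma tent_le1 p q x : 0 <= p <= q -> q <= 1 -> tent p q x <= 1.
Proof.
move=> /andP[p0 pq] q1; have [/andP[px xq]|N] := boolP (p < x < q); last first.
  by rewrite tent_out.
rewrite tent_in ?ltW//; nra.
Qed.

Lemma tent_lip p q x y : 0 <= p <= q -> q <= 1 ->
  `|tent p q y - tent p q x| <= `|y - x|.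
Proof.
move=> /[dup] pq0 /andP[p0 pq] q1; wlog xy : x y / x <= y.
  move=> W; have [/W//|/ltW/W] := leP x y.
  by rewrite distrC (distrC y).
rewrite [leRHS]ger0_norm ?subr_ge0// ler_norml.
have [/andP[px xq]|Nx] := boolP (p < x < q); have [/andP[py yq]|Ny] := boolP (p < y < q).
- have -> : tent p q x = (x - p) * (q - x) by rewrite tent_in ?ltW.
  have -> : tent p q y = (y - p) * (q - y) by rewrite tent_in ?ltW.
  apply/andP; split; nra.
- have -> : tent p q x = (x - p) * (q - x) by rewrite tent_in ?ltW.
  have qy : q <= y by move: Ny; rewrite negb_and -!leNgt => /orP[]//; lra.
  rewrite (tent_out pq Ny); apply/andP; split; nra.
- have -> : tent p q y = (y - p) * (q - y) by rewrite tent_in ?ltW.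
  have xp : x <= p by move: Nx; rewrite negb_and -!leNgt => /orP[]//; lra.
  rewrite (tent_out pq Nx); apply/andP; split; nra.
- rewrite !tent_out// subrr; apply/andP; split; lra.
Qed.

Lemma bump_ge0 p q x : 0 <= bump p q x.
Proof. exact: sqr_ge0. Qed.

Lemma bump_out p q x : p <= q -> ~~ (p < x < q) -> bump p q x = 0.
Proof. by move=> pq /(tent_out pq); rewrite /bump => ->; rewrite expr0n. Qed.

Lemma bump_gt0 p q x : p < x < q -> 0 < bump p q x.
Proof.
move=> /[dup] pxq /andP[px xq].
by rewrite exprn_gt0// tent_gt0// ltW// (lt_trans px).
Qed.

Lemma bump_le1 p q x : 0 <= p <= q -> q <= 1 -> bump p q x <= 1.
Proof. by move=> pq q1; rewrite exprn_ile1 ?tent_ge0 ?tent_le1. Qed.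

Lemma bump_lip p q x y : 0 <= p <= q -> q <= 1 ->
  `|bump p q y - bump p q x| <= 2 * `|y - x|.
Proof.
move=> pq q1; rewrite /bump subr_sqr normrM mulrC.
apply: ler_pM => //; last exact: tent_lip.
rewrite ger0_norm ?addr_ge0 ?tent_ge0//.
by have := tent_le1 x pq q1; have := tent_le1 y pq q1; lra.
Qed.

Lemma dbump_le p q x : 0 <= p <= q -> q <= 1 -> `|dbump p q x| <= 2.
Proof.
move=> /[dup] pq0 /andP[p0 pq] q1; rewrite /dbump.
have [/andP[px xq]|N] := boolP (p < x < q); last first.
  by rewrite tent_out// mulr0 mul0r normr0.
have t0 := tent_ge0 p q x; have t1 := tent_le1 x pq0 q1.
rewrite -mulrA normrM ger0_norm// ler_piMr// normrM (ger0_norm t0) mulr_ile1//.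
by rewrite ler_norml; apply/andP; split; lra.
Qed.

(** The constant is 1 + 2. With both points inside, the remainder is the square of the increment of
    [tent] minus [2 * tent p q x * (y - x) ^+ 2]; with only [x] inside, [tent p q x <= |y - x|]
    bounds the two terms separately. *)
Lemma bump_taylor p q x y : 0 <= p <= q -> q <= 1 ->
  `|bump p q y - bump p q x - dbump p q x * (y - x)| <= 3 * (y - x) ^+ 2.
Proof.
move=> /[dup] pq0 /andP[p0 pq] q1.
have tl := tent_lip x y pq0 q1.
have tl2 : (tent p q y - tent p q x) ^+ 2 <= (y - x) ^+ 2.
  by rewrite -(real_normK (num_real (y - x)))
    -(real_normK (num_real (_ - tent p q x))) ler_sqr ?nnegrE.
have sq0 := sqr_ge0 (y - x).
have [xpq|Nx] := boolP (p < x < q); last first.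
  rewrite /dbump /bump (tent_out pq Nx) in tl2 *.
  rewrite mulr0 !mul0r expr0n/= !subr0 in tl2 *.
  by rewrite ger0_norm ?sqr_ge0//; lra.
have t0 := tent_ge0 p q x; have t1 := tent_le1 x pq0 q1.
have /andP[px xq] := xpq.
have [ypq|Ny] := boolP (p < y < q).
  have -> : bump p q y - bump p q x - dbump p q x * (y - x) =
      (tent p q y - tent p q x) ^+ 2 - 2 * tent p q x * (y - x) ^+ 2.
    have /andP[py yq] := ypq.
    by rewrite /dbump /bump !tent_in ?ltW//; ring.
  have s0 := sqr_ge0 (tent p q y - tent p q x).
  have : tent p q x * (y - x) ^+ 2 <= 1 * (y - x) ^+ 2 by rewrite ler_wpM2r.
  have : 0 <= tent p q x * (y - x) ^+ 2 by rewrite mulr_ge0.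
  by rewrite -mulrA ler_norml => *; apply/andP; split; lra.
rewrite /dbump /bump (tent_out pq Ny) in tl *; rewrite expr0n/= sub0r.
rewrite sub0r normrN ger0_norm// in tl.
apply: le_trans (ler_normB _ _) _; rewrite normrN.
rewrite -(real_normK (num_real (y - x))).
have d1 : `|p + q - 2 * x| <= 1 by rewrite ler_norml; apply/andP; split; lra.
have n0 : 0 <= `|y - x| by [].
have e1 : `|tent p q x ^+ 2| <= `|y - x| ^+ 2.
  by rewrite ger0_norm ?sqr_ge0// ler_sqr ?nnegrE.
have e2 : `|2 * tent p q x * (p + q - 2 * x) * (y - x)| <= 2 * `|y - x| ^+ 2.
  rewrite !normrM (ger0_norm t0) ger0_norm// -!mulrA ler_pM2l// expr2 ler_pM ?mulr_ge0//.
  by rewrite ler_piMl.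
lra.
Qed.

End bumps.

(** * Homeomorphisms coded by sequences of signs *)

Section coded_homeomorphisms.
Variable R : realType.
Implicit Types (P N : set R) (c : nat -> R) (x y : R).

(* The pairs which are not of the form [0 <= p <= q <= 1] are sent to [(0, 0)], whose
   bump vanishes. *)
Definition rat_pair (n : nat) : R * R :=
  if unpickle n is Some (p, q) then
    if (0 <= (p : rat) <= q) && (q <= 1) then (ratr p, ratr q) else (0, 0)
  else (0, 0).

Lemma rat_pairP n : 0 <= (rat_pair n).1 <= (rat_pair n).2 /\ (rat_pair n).2 <= 1.
Proof.
rewrite /rat_pair; case: unpickle => [[p q]|]; last by rewrite /= lexx ler01.
case: ifP => [/andP[/andP[p0 pq] q1]|_] /=; last by rewrite lexx ler01.
by rewrite ler_rat -(ler_rat R 0) -(ler_rat R q) ?rmorph0 ?rmorph1 in p0 q1 *; rewrite p0.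
Qed.

Definition rat_gap n : set R := [set x | (rat_pair n).1 < x < (rat_pair n).2].

Lemma rat_gap_base (U : set R) x : open U -> U `<=` [set x | 0 < x < 1] -> U x ->
  exists2 n, rat_gap n x & rat_gap n `<=` U.
Proof.
move=> oU U01 Ux.
have : nbhs x U by exact: open_nbhs_nbhs.
rewrite -nbhs_ballE => -[e /= e0 eU].
have /andP[x0 x1] := U01 _ Ux.
(* The distances to 0 and 1 keep the rational ends in [[0, 1]], so that [rat_pair] does not replace
   the pair by its default. *)
have d0 : 0 < Num.min e (Num.min x (1 - x)) by rewrite !lt_min e0 x0 subr_gt0.
have [p [q [pxq H]]] := rat_ball x d0.
have /andP[px xq] := pxq.
have pq : p <= q by rewrite -(ler_rat R) ltW// (lt_trans px).
have rp : rat_pair (pickle (p, q)) = (ratr p, ratr q).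
  rewrite /rat_pair pickleK pq andbT.
  suff [-> ->] : 0 <= p /\ q <= 1 by [].
  split; rewrite -(ler_rat R) ?rmorph0 ?rmorph1 leNgt; apply/negP => lt.
    have := H 0; rewrite lt (lt_trans x0 xq) => /(_ isT).
    by rewrite subr0 ger0_norm ?(ltW x0)// !lt_min ltxx !andbF.
  have := H 1; rewrite lt (lt_trans px x1) => /(_ isT).
  by rewrite distrC ger0_norm ?subr_ge0 ?(ltW x1)// !lt_min ltxx !andbF.
exists (pickle (p, q)); rewrite /rat_gap rp//= => y /H yx; apply: eU.
by rewrite /ball/=; apply: lt_le_trans yx _; rewrite ge_min lexx.
Qed.

Definition cbump n x := bump (rat_pair n).1 (rat_pair n).2 x.
Definition dcbump n x := dbump (rat_pair n).1 (rat_pair n).2 x.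

(** Bumps are 2-Lipschitz, so the factor 1/4 makes the displacement 1/2-Lipschitz when all
    [|c n| <= 1], and adding it to the identity gives a bi-Lipschitz map; [ddisp] is its
    derivative. *)
Definition disp c x := wsum (fun n => c n * cbump n x) / 4.
Definition ddisp c x := wsum (fun n => c n * dcbump n x) / 4.

Lemma cmul_le (M : R) c (u : nat -> R) : (forall n, `|c n| <= 1) ->
  (forall n, `|u n| <= M) -> forall n, `|c n * u n| <= M.
Proof. by move=> c1 uM n; rewrite normrM; apply: le_trans (uM n); rewrite ler_piMl. Qed.

Lemma cbump_le1 n x : `|cbump n x| <= 1.
Proof. by have [? ?] := rat_pairP n; rewrite ger0_norm ?bump_ge0// bump_le1. Qed.

Lemma dcbump_le n x : `|dcbump n x| <= 2.
Proof. by have [? ?] := rat_pairP n; exact: dbump_le. Qed.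

Section coefficients.
Variable c : nat -> R.
Hypothesis c1 : forall n, `|c n| <= 1.

Lemma cbump_bounded x : wbounded (fun n => c n * cbump n x).
Proof. by exists 1; apply: (cmul_le c1) => n; exact: cbump_le1. Qed.

Lemma dcbump_bounded x : wbounded (fun n => c n * dcbump n x).
Proof. by exists 2; apply: (cmul_le c1) => n; exact: dcbump_le. Qed.

Lemma disp_lip x y : `|disp c y - disp c x| <= 2^-1 * `|y - x|.
Proof.
rewrite /disp -mulrBl -wsumB; [|exact: cbump_bounded..].
rewrite normrM [X in _ * X]ger0_norm ?invr_ge0//.
rewrite (_ : 2^-1 * _ = 2 * `|y - x| / 4); last by field.
rewrite ler_pM2r ?invr_gt0//; apply: wsum_le => n.
rewrite -mulrBr; apply: (cmul_le c1 (u := fun n => cbump n y - cbump n x)) => m.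
by have [? ?] := rat_pairP m; exact: bump_lip.
Qed.

(* The quadratic remainder makes [disp c] differentiable at every point, so that
   the integral in [dAC] can be estimated pointwise. *)
Lemma disp_taylor x y :
  `|disp c y - disp c x - ddisp c x * (y - x)| <= (y - x) ^+ 2.
Proof.
rewrite /disp /ddisp mulrAC -!mulrBl -wsumB; [|exact: cbump_bounded..].
rewrite [wsum _ * (y - x)]mulrC -wsumZ; last exact: dcbump_bounded.
have b1 : wbounded (fun n => c n * cbump n y - c n * cbump n x).
  have [M cM] := wboundedD (cbump_bounded y) (wboundedZ (-1) (cbump_bounded x)).
  by exists M => n; have := cM n; rewrite mulN1r.
rewrite -wsumB//; last exact/wboundedZ/dcbump_bounded.
rewrite normrM [X in _ * X]ger0_norm ?invr_ge0//.
rewrite ler_pdivrMr//.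
apply: (@le_trans _ _ (3 * (y - x) ^+ 2)); last first.
  by have := sqr_ge0 (y - x); lra.
apply: wsum_le => n.
rewrite (_ : _ - _ = c n * (cbump n y - cbump n x - dcbump n x * (y - x))); last by ring.
apply: (cmul_le c1 (u := fun n => cbump n y - cbump n x - dcbump n x * (y - x))) => m.
by have [? ?] := rat_pairP m; exact: bump_taylor.
Qed.

Lemma disp_le x : `|disp c x| <= 4^-1.
Proof.
rewrite /disp normrM [X in _ * X]ger0_norm ?invr_ge0// ler_piMl ?invr_ge0//.
by apply: wsum_le; apply: (cmul_le c1) => n; exact: cbump_le1.
Qed.

Lemma disp_out x : ~~ (0 < x < 1) -> disp c x = 0.
Proof.
move=> xN; rewrite /disp (_ : (fun n => _) = fun n => 0).
  have := @wsum_le R (fun=> 0) 0; rewrite normr0 => /(_ (fun=> lexx 0)).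
  by rewrite normr_le0 => /eqP ->; rewrite mul0r.
apply/funext => n; rewrite /cbump bump_out ?mulr0//.
  by have [/andP[]] := rat_pairP n.
have [/andP[p0 _] q1] := rat_pairP n.
by apply: contra xN => /andP[px xq]; rewrite (le_lt_trans p0 px) (lt_le_trans xq q1).
Qed.

(** Both [h] and its inverse are 2-Lipschitz, hence satisfy (N). As [|disp| <= 1/4], every [y] is a
    value taken on [[y - 1, y + 1]]. *)
Lemma coded_auto : exists hi, ac_auto (fun x => x + disp c x) hi.
Proof.
set h := fun x => _.
have up x y : x <= y -> 2^-1 * (y - x) <= h y - h x.
  move=> xy; have := disp_lip x y; rewrite (ger0_norm (_ : 0 <= y - x)) ?subr_ge0//.
  by rewrite ler_norml /h => /andP[h1 h2]; lra.
have down x y : x <= y -> h y - h x <= 2 * (y - x).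
  move=> xy; have := disp_lip x y; rewrite (ger0_norm (_ : 0 <= y - x)) ?subr_ge0//.
  by rewrite ler_norml /h => /andP[h1 h2]; lra.
have hh : {homo h : x y / x < y} by move=> x y xy; have := up x y (ltW xy); lra.
have hm : {mono h : x y / x <= y} by exact: le_mono.
have hc : continuous h.
  move=> x; apply/cvgrPdist_lt => e e0; near=> y.
  apply: (@le_lt_trans _ _ (2 * `|x - y|)).
    have [xy|/ltW yx] := leP x y.
      have hxy : h x <= h y by rewrite hm.
      by rewrite !ler0_norm ?subr_le0// !opprB; exact: down.
    have hyx : h y <= h x by rewrite hm.
    by rewrite !ger0_norm ?subr_ge0//; exact: down.
  rewrite mulrC -ltr_pdivlMr//; near: y.
  by exists (e / 2) => //=; exact: divr_gt0.
have onto y : exists x, h x = y.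
  have cf : {within `[y - 1, y + 1], continuous h} by exact: continuous_subspaceT.
  have yy : y - 1 <= y + 1 by lra.
  have mm : Num.min (h (y - 1)) (h (y + 1)) <= y <= Num.max (h (y - 1)) (h (y + 1)).
    have := disp_le (y - 1); have := disp_le (y + 1); rewrite !ler_norml ge_min le_max /h.
    move=> /andP[? ?] /andP[? ?]; apply/andP; split; apply/orP; [left|right]; lra.
  by have [x _ hx] := IVT yy cf mm; exists x.
have [hi hiK] := choice onto.
have hK : cancel h hi by move=> x; apply: (inc_inj hm); rewrite hiK.
exists hi; split => //.
- by move=> x /disp_out x0; rewrite /h x0 addr0.
- apply: (@lusin_lipschitz _ _ 2) => //; exact: ltW_homo.
- have him : {mono hi : x y / x <= y} by move=> x y; rewrite -hm !hiK.
  apply: (@lusin_lipschitz _ _ 2) => // x y xy; first by rewrite him.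
  have := up (hi x) (hi y); rewrite !hiK him => /(_ xy); lra.
Unshelve. all: by end_near. Qed.

End coefficients.

Lemma disp_close c c' (K : nat) : (forall n, `|c n| <= 1) -> (forall n, `|c' n| <= 1) ->
  (forall n, (n < K)%N -> c n = c' n) -> forall x,
  `|disp c x - disp c' x| <= 2^-1 ^+ K /\ `|ddisp c x - ddisp c' x| <= 2^-1 ^+ K.
Proof.
move=> c1 c1' cc x; have cd n : `|c n - c' n| <= 2.
  by apply: le_trans (ler_normB _ _) _; have := c1 n; have := c1' n; lra.
(* Coefficients differ by at most 2 and [cbump], [dcbump] are bounded by 2; the division by 4
   cancels the product. *)
have aux (u : nat -> R) M : (forall n, `|u n| <= M) -> M <= 2 ->
    `|wsum (fun n => c n * u n) / 4 - wsum (fun n => c' n * u n) / 4| <= 2^-1 ^+ K.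
  move=> uM M2; have M0 : 0 <= M by exact: le_trans (normr_ge0 _) (uM 0%N).
  have b c0 : (forall n, `|c0 n| <= 1) -> wbounded (fun n => c0 n * u n).
    by move=> c01; exists M; exact: cmul_le.
  rewrite -mulrBl -wsumB; [|exact: b..].
  rewrite normrM [X in _ * X]ger0_norm ?invr_ge0// ler_pdivrMr// mulrC.
  apply: wsum_tail => n; first by move=> /cc ->; rewrite subrr.
  rewrite -mulrBl normrM (_ : 4 = 2 * 2); last by rewrite -natrM.
  by apply: ler_pM => //; exact: le_trans (uM n) M2.
split; first by apply: (aux _ 1) => [n|]; [exact: cbump_le1|rewrite ler1n].
by apply: (aux _ 2) => // n; exact: dcbump_le.
Qed.

Lemma disp_gt0 c x k : (forall n, `|c n| <= 1) -> rat_gap k x -> 0 < c k ->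
  (forall n, rat_gap n x -> 0 <= c n) -> 0 < disp c x.
Proof.
move=> c1 kx ck cx; rewrite divr_gt0//; apply: (@wsum_gt0 _ _ k).
- exact: cbump_bounded.
- move=> n; have [nx|nx] := boolP ((rat_pair n).1 < x < (rat_pair n).2).
    by rewrite mulr_ge0 ?bump_ge0 ?cx.
  by rewrite /cbump bump_out ?mulr0//; have [/andP[]] := rat_pairP n.
- by rewrite mulr_gt0// bump_gt0.
Qed.

Lemma dispN c x : (forall n, `|c n| <= 1) -> disp (fun n => - c n) x = - disp c x.
Proof.
move=> c1; rewrite /disp -mulNr -mulN1r -wsumZ; last exact: cbump_bounded.
by congr (wsum _ / 4); apply/funext => n; rewrite mulN1r mulNr.
Qed.

Lemma disp_eq0 c x : (forall n, rat_gap n x -> c n = 0) -> disp c x = 0.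
Proof.
move=> cx; rewrite /disp (_ : (fun n => _) = fun n => 0).
  have := @wsum_le R (fun=> 0) 0; rewrite normr0 => /(_ (fun=> lexx 0)).
  by rewrite normr_le0 => /eqP ->; rewrite mul0r.
apply/funext => n; have [nx|nx] := boolP ((rat_pair n).1 < x < (rat_pair n).2).
  by rewrite cx// mul0r.
by rewrite /cbump bump_out ?mulr0//; have [/andP[]] := rat_pairP n.
Qed.

Definition coef (s : nat -> bool * bool) n : R := (s n).1%:R - (s n).2%:R.

Lemma coef_le1 s n : `|coef s n| <= 1.
Proof.
rewrite /coef; case: (s n) => -[] [] /=;
  by rewrite ?subrr ?subr0 ?sub0r ?normrN ?normr0 ?normr1.
Qed.

Definition gap_code P N n := (`[< rat_gap n `<=` P >], `[< rat_gap n `<=` N >]).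

(** Some rational interval around a point of [P] lies in [P], and by disjointness none containing
    the point lies in [N]: at that point all terms are nonnegative and one is positive. *)
Lemma gap_code_sign P N x : open P -> open N -> P `&` N = set0 ->
  P `<=` [set x | 0 < x < 1] -> N `<=` [set x | 0 < x < 1] ->
  [/\ P x -> 0 < disp (coef (gap_code P N)) x,
      N x -> disp (coef (gap_code P N)) x < 0 &
      ~ P x -> ~ N x -> disp (coef (gap_code P N)) x = 0].
Proof.
move=> oP oN PN P01 N01.
have disj y : P y -> N y -> False by move=> Py Ny; suff : set0 y by []; rewrite -PN.
split.
- move=> Px; have [k kx kP] := rat_gap_base oP P01 Px.
  have nN n : rat_gap n x -> `[< rat_gap n `<=` N >] = false.
    by move=> nx; apply/asboolP => /(_ _ nx); exact: disj.
  apply: (disp_gt0 (k := k)) => //; first exact: coef_le1.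
    by rewrite /coef /= nN// subr0; case: asboolP.
  by move=> n nx; rewrite /coef /= nN// subr0.
- move=> Nx; have [k kx kN] := rat_gap_base oN N01 Nx.
  have nP n : rat_gap n x -> `[< rat_gap n `<=` P >] = false.
    by move=> nx; apply/asboolP => /(_ _ nx) Px; exact: disj Nx.
  rewrite -oppr_gt0 -dispN; last exact: coef_le1.
  apply: (disp_gt0 (k := k)) => //; first by move=> n; rewrite normrN; exact: coef_le1.
    by rewrite /coef /= nP// sub0r opprK; case: asboolP.
  by move=> n nx; rewrite /coef /= nP// sub0r opprK.
- move=> Px Nx; apply: disp_eq0 => n nx; rewrite /coef /=.
  by case: asboolP => [/(_ _ nx)//|_]; case: asboolP => [/(_ _ nx)//|_]; rewrite subrr.
Qed.

End coded_homeomorphisms.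

(** * Continuity of the coding for the metric of AC([0,1]) *)

Section coded_distance.
Import HBNNSimple.
Variable R : realType.
Local Notation lam := (@lebesgue_measure R).

Lemma unit_derive_coded (f : I01 R -> I01 R) (c : nat -> R) (t : R) :
  (forall n, `|c n| <= 1) -> ext f = (fun x => x + disp c x) -> 0 < t < 1 ->
  unit_derive f t = 1 + ddisp c t.
Proof.
move=> c1 fE /andP[t0 t1]; apply: cvg_lim => //.
set g := 'valL_ 0 _.
have gE x : 0 <= x <= 1 -> g x = x + disp c x.
  move=> x01; rewrite /g /valL_ /= oinv_set_val -(val_projI x01) valK /=.
  by rewrite -ext_val fE.
(* The remainder is at most [h ^+ 2], so [|h| < e] suffices; [|h| < min(t, 1 - t)] keeps [h + t]
   away from the values 0 of the extension. *)
apply/cvgrPdist_lt => e e0; near=> h.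
have h0 : h != 0 by near: h; exact: nbhs_dnbhs_neq.
have he : `|h| < e by near: h; exact: dnbhs0_lt.
have ht : `|h| < Num.min t (1 - t).
  by near: h; apply: dnbhs0_lt; rewrite lt_min t0 subr_gt0.
rewrite lt_min !ltr_norml in ht; have /andP[/andP[h1 h2] /andP[h3 h4]] := ht.
rewrite !gE; [|by apply/andP; split; lra..].
have := disp_taylor c1 t (h + t); rewrite addrK => H.
rewrite distrC.
have -> : h^-1 *: (h + t + disp c (h + t) - (t + disp c t)) - (1 + ddisp c t) =
    h^-1 * (disp c (h + t) - disp c t - ddisp c t * h).
  by rewrite /GRing.scale /=; field.
rewrite normrM normfV mulrC ltr_pdivrMr ?normr_gt0//.
apply: (le_lt_trans H); rewrite -(real_normK (num_real h)) expr2.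
by rewrite ltr_pM2r ?normr_gt0.
Unshelve. all: by end_near. Qed.

(* No measurability is assumed of [g], and its values at the endpoints, where
   [unit_derive] is junk, are irrelevant. *)
Lemma Rintegral_unit_le (g : R -> R) (e : R) : 0 <= e -> (forall t, 0 <= g t) ->
  (forall t, 0 < t < 1 -> g t <= e) ->
  \int[lebesgue_measure]_(t in @unit_interval R) g t <= e.
Proof.
move=> e0 g0 ge.
have mI : measurable (@unit_interval R) by exact: measurable_itv.
suff H : (\int[lam]_(t in @unit_interval R) (g t)%:E <= e%:E)%E.
  have i0 : (0 <= \int[lam]_(t in @unit_interval R) (g t)%:E)%E.
    by apply: integral_ge0 => t _; rewrite lee_fin.
  rewrite /Rintegral -lee_fin fineK// fin_real// (lt_le_trans _ i0) ?ltNyr//=.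
  by rewrite (le_lt_trans H)// ltry.
rewrite integral_mkcond ge0_integralTE; last first.
  by move=> t; rewrite patchE; case: ifP => // _; rewrite lee_fin.
(* The integral of a nonnegative function is a supremum over the simple functions below it, and only
   these are compared, off the null set [{0, 1}], with [e] times the indicator. *)
apply: ge_ereal_sup => _ [h hg <-].
rewrite -integralT_nnsfun.
apply: (@le_trans _ _ (\int[lam]_t (e * \1_(@unit_interval R) t)%:E)%E).
  apply: ae_ge0_le_integral => //.
  - by move=> t _; rewrite lee_fin; exact: fun_ge0.
  - exact/measurable_EFinP.
  - by move=> t _; rewrite lee_fin mulr_ge0.
  - by apply/measurable_EFinP; apply: measurable_funM.
  - exists ([set 0] `|` [set 1]); split.
    + by apply: measurableU; exact: measurable_set1.
    + apply/eqP; rewrite eq_le measure_ge0 andbT.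
      apply: le_trans (measureU2 _ _ _) _; [exact: measurable_set1|exact: measurable_set1|].
      by rewrite /lam/= !lebesgue_measure_set1 adde0.
    + move=> t /=; apply: contra_notP => t01 _.
      rewrite lee_fin; have := hg t; rewrite patchE.
      case: ifPn => tI; rewrite lee_fin => /le_trans; apply; last first.
        by rewrite mulr_ge0.
      rewrite indicE tI mulr1; apply: ge.
      move: tI; rewrite inE /unit_interval/= in_itv/= => /andP[t0 t1].
      rewrite !lt_neqAle t0 t1 !andbT; apply/andP; split;
        apply/eqP => tE; apply: t01; [left|right] => //=.
under eq_integral do rewrite EFinM.
rewrite ge0_integralZl//; last by apply/measurable_EFinP; exact: measurable_indic.
rewrite integral_indic// setIT /lam/= lebesgue_itv_cc// subr0.
by rewrite mule1.
Qed.

Lemma dAC_coded (f g : AC01 R) (c c' : nat -> R) (K : nat) :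
  (forall n, `|c n| <= 1) -> (forall n, `|c' n| <= 1) ->
  (forall n, (n < K)%N -> c n = c' n) ->
  ext f = (fun x => x + disp c x) -> ext g = (fun x => x + disp c' x) ->
  dAC f g <= 2 * 2^-1 ^+ K.
Proof.
move=> c1 c1' cc fE gE; have H := disp_close c1 c1' cc.
rewrite /dAC mulrDl mul1r; apply: lerD.
  apply: ge_sup; first by exists `|val (f (projI 0)) - val (g (projI 0))|, (projI 0).
  move=> _ [t _ <-]; rewrite -!ext_val fE gE opprD addrACA subrr add0r.
  by have [] := H (val t).
apply: Rintegral_unit_le => // t t01.
rewrite (unit_derive_coded c1 fE t01) (unit_derive_coded c1' gE t01).
by rewrite opprD addrACA subrr add0r; have [] := H t.
Qed.

Lemma exists_coded : exists F : (nat -> bool * bool) -> AC01 R,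
  forall s, ext (F s) = (fun x => x + disp (coef R s) x).
Proof.
have H s : exists f : AC01 R, ext f = (fun x => x + disp (coef R s) x).
  have [hi H] := coded_auto (coef_le1 R s).
  by have [f [fE _]] := ac_autoP H; exists f.
by have [F FE] := choice H; exists F.
Qed.

(* [F] is continuous for the product topology on codes, so the preimage of an open
   set is a countable union of cylinders. *)
Lemma measurable_coded (X : ptopologicalType) (F : (nat -> bool * bool) -> AC01 R)
    (code : X -> nat -> bool * bool) :
  (forall s, ext (F s) = (fun x => x + disp (coef R s) x)) ->
  (forall n, (@measurable _ (borel X)) [set x | (code x n).1]) ->
  (forall n, (@measurable _ (borel X)) [set x | (code x n).2]) ->
  measurable_fun setT ((fun x => F (code x)) : borel X -> borel (AC01 R)).
Proof.
move=> FE m1 m2.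
apply: (@measurability _ _ (borel X) (borel (AC01 R)) setT
  (fun x => F (code x)) (@open (AC01 R))) => //.
move=> _ [W oW <-]; rewrite setTI.
have mP n (b : bool * bool) : (@measurable _ (borel X)) [set x | code x n = b].
  have -> : [set x | code x n = b] =
     (if b.1 then [set x | (code x n).1] else ~` [set x | (code x n).1]) `&`
     (if b.2 then [set x | (code x n).2] else ~` [set x | (code x n).2]).
    case: b => b1 b2; apply/seteqP; split => x /=.
      by move=> E; split; [case: b1 E|case: b2 E] => E /=; rewrite E.
    case=> x1 x2; rewrite [LHS]surjective_pairing.
    by congr pair; [case: b1 x1|case: b2 x2] => //= /negP/negPf.
  by apply: measurableI; case: ifP => _ //; exact: measurableC.
(* The points whose code has prefix [l], kept when [F] sends the whole cylinder of [l] into [W]. *)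
pose M (l : seq (bool * bool)) : set (borel X) :=
  if `[< forall s, (forall n, (n < size l)%N -> s n = nth (false, false) l n) -> W (F s) >]
  then [set x | forall n, n \in iota 0 (size l) -> [set x | code x n = nth (false, false) l n] x]
  else set0.
have -> : (fun x => F (code x)) @^-1` W = \bigcup_l M l.
  apply/seteqP; split => x /=; last first.
    move=> [l _]; rewrite /M; case: asboolP => // H Hx; apply: H => n nl.
    by apply: Hx; rewrite mem_iota.
  move=> /oW[e e0 eW].
  have [K Ke] : exists K, 2 * 2^-1 ^+ K < e.
    exists (Num.trunc (2 / e)).+1.
    have tK : 2 / e < 2 ^+ (Num.trunc (2 / e)).+1.
      apply: (lt_trans (truncnS_gt _)); rewrite -natrX ltr_nat.
      exact: ltn_expl.
    by rewrite exprVn ltr_pdivrMr ?exprn_gt0// mulrC -ltr_pdivrMr.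
  pose l := mkseq (code x) K.
  exists l => //; rewrite /M; case: asboolP => [_ n|/=].
    by rewrite mem_iota /= size_mkseq => nK; rewrite nth_mkseq.
  case=> s; rewrite size_mkseq => sE; apply: eW.
  apply: le_lt_trans Ke.
  apply: dAC_coded (FE _) (FE _) => [n|n|n nK]; [exact: coef_le1|exact: coef_le1|].
  by rewrite /coef sE// nth_mkseq.
apply: countable_bigcupT_measurable; first exact: countableP.
move=> l; rewrite /M; case: asboolP => _; last exact: measurable0.
apply: (@measurable_forall_seq _ (borel X) _
  (fun n => [set x | code x n = nth (false, false) l n])).
by move=> n; exact: mP.
Qed.

End coded_distance.

(** * The sets moved up and down, and their equivalences *)

Section sets_to_conjugacy.
Variable R : realType.
Implicit Types (F : closed_subsets (I01 R)) (A : set R) (x y t : R).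

(* [A] is copied into [[1/4, 3/4]], whose ends are recognized as those of the set
   moved down; the intervals [(0, 1/8)] and [(7/8, 1)] record whether [A] contains
   0 and 1. *)
Definition up_set A : set R :=
  [set x | 1 / 4 < x < 3 / 4 /\ ~ A (2 * x - 1 / 2)] `|`
  ([set x | 0 < x < 1 / 8 /\ ~ A 0] `|` [set x | 7 / 8 < x < 1 /\ ~ A 1]).

Definition down_set : set R :=
  [set x | 1 / 8 < x < 1 / 4] `|` [set x | 3 / 4 < x < 7 / 8].

Lemma open_itv_set (a b : R) : open [set x | a < x < b].
Proof.
have : open `]a, b[%classic by exact: itv_open.
by congr open; apply/seteqP; split => x /=; rewrite in_itv.
Qed.

Lemma open_itv_and (a b : R) (C : Prop) : open [set x | a < x < b /\ C].
Proof.
have [c|c] := pselect C.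
  have := @open_itv_set a b; congr open.
  by apply/seteqP; split => x /=; [split|case].
by rewrite (_ : [set _ | _] = set0) ?open0//; apply/seteqP; split => x // [].
Qed.

Lemma open_up_set A : closed A -> open (up_set A).
Proof.
move=> cA; apply: openU; last by apply: openU; exact: open_itv_and.
have -> : [set x | 1 / 4 < x < 3 / 4 /\ ~ A (2 * x - 1 / 2)] =
    [set x | 1 / 4 < x < 3 / 4] `&` (fun x => 2 * x - 1 / 2) @^-1` (~` A).
  by apply/seteqP; split.
apply: openI; first exact: open_itv_set.
apply: open_comp; last by rewrite openC.
move=> x _; apply: cvgB; last exact: cvg_cst.
by apply: cvgM; [exact: cvg_cst|exact: cvg_id].
Qed.

Lemma open_down_set : open down_set.
Proof. by apply: openU; exact: open_itv_set. Qed.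

Lemma up_down_disjoint A : up_set A `&` down_set = set0.
Proof.
apply/seteqP; split => // x [[[/andP[? ?] _]|[[/andP[? ?] _]|[/andP[? ?] _]]]
  [/andP[? ?]|/andP[? ?]]] /=; lra.
Qed.

Lemma up_set_unit A : up_set A `<=` [set x | 0 < x < 1].
Proof. by move=> x [[/andP[? ?] _]|[[/andP[? ?] _]|[/andP[? ?] _]]] /=; apply/andP; split; lra. Qed.

Lemma down_set_unit : down_set `<=` [set x | 0 < x < 1].
Proof. by move=> x [/andP[? ?]|/andP[? ?]] /=; apply/andP; split; lra. Qed.

Lemma up_set_mid A x : 1 / 4 < x < 3 / 4 -> up_set A x <-> ~ A (2 * x - 1 / 2).
Proof.
move=> /[dup] xm /andP[x1 x2]; split=> [[[_ //]|[[/andP[? ?] _]|[/andP[? ?] _]]]|Ax].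
- lra.
- lra.
- by left.
Qed.

Lemma up_set_low A x : 0 < x < 1 / 4 -> up_set A x <-> x < 1 / 8 /\ ~ A 0.
Proof.
move=> /andP[x1 x2]; split=> [[[/andP[? ?] _]|[[/andP[? ?] //]|[/andP[? ?] _]]]|[x8 A0]].
- lra.
- lra.
- by right; left; rewrite /= x1.
Qed.

Lemma up_set_high A x : 3 / 4 < x < 1 -> up_set A x <-> 7 / 8 < x /\ ~ A 1.
Proof.
move=> /andP[x1 x2]; split=> [[[/andP[? ?] _]|[[/andP[? ?] _]|[/andP[? ?] ?]]]|[x8 A0]] //.
- lra.
- lra.
- by right; right; rewrite /= x2 andbT.
Qed.

Lemma up_set_ends A x : ~~ (1 / 4 < x < 3 / 4) ->
  up_set A x <-> ((0 < x < 1 / 8 /\ ~ A 0) \/ (7 / 8 < x < 1 /\ ~ A 1)).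
Proof.
by move=> xN; split=> [[[x1 _]|//]|]; [rewrite x1 in xN|right].
Qed.

Lemma up_set_conj A1 A2 h hi : ac_auto h hi -> (forall x, A1 x <-> A2 (h x)) ->
  exists k ki, [/\ ac_auto k ki, forall x, up_set A1 x <-> up_set A2 (k x) &
    forall x, down_set x <-> down_set (k x)].
Proof.
move=> H hA.
(* The conjugate of [h] by the affine map of [[1/4, 3/4]] onto [[0, 1]], in the form expected by
   [lusin_affine]. *)
pose k x := 2^-1 * h (2 * x + - (1 / 2)) + 1 / 4.
pose ki x := 2^-1 * hi (2 * x + - (1 / 2)) + 1 / 4.
have aux f fi : ac_auto f fi -> cancel (fun x => 2^-1 * f (2 * x + - (1 / 2)) + 1 / 4)
    (fun x => 2^-1 * fi (2 * x + - (1 / 2)) + 1 / 4).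
  move=> Hf x /=.
  have -> : 2 * (2^-1 * f (2 * x + - (1 / 2)) + 1 / 4) + - (1 / 2) = f (2 * x + - (1 / 2)) by field.
  by rewrite (acK Hf); field.
have lus f : lusin f -> lusin (fun x => 2^-1 * f (2 * x + - (1 / 2)) + 1 / 4).
  move=> lf; apply: (lusin_comp (lusin_affine (1 / 4) (_ : 0 < 2^-1))); first by rewrite invr_gt0.
  exact: (lusin_comp lf (lusin_affine _ _)).
have kout x : ~~ (1 / 4 < x < 3 / 4) -> k x = x.
  move=> xN; rewrite /k (ac_out H); first by field.
  by apply: contra xN => /andP[? ?]; apply/andP; split; lra.
have K : ac_auto k ki.
  split.
  - exact: aux H.
  - exact: aux (ac_inv H).
  - move=> x y xy; rewrite /k ltrD2r ltr_pM2l ?invr_gt0// (ac_lt H); lra.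
  - by move=> x xN; apply: kout; apply: contra xN => /andP[? ?]; apply/andP; split; lra.
  - exact/lus/(ac_lusin H).
  - exact/lus/(ac_lusin_inv H).
have k14 : k (1 / 4) = 1 / 4 by apply: kout; rewrite ltxx.
have k34 : k (3 / 4) = 3 / 4 by apply: kout; rewrite ltxx andbF.
have h0 : h 0 = 0 by apply: (ac_out H); rewrite ltxx.
have h1 : h 1 = 1 by apply: (ac_out H); rewrite ltxx andbF.
exists k, ki; split => // x.
  have [xm|xN] := boolP (1 / 4 < x < 3 / 4).
    have km : 1 / 4 < k x < 3 / 4 by rewrite -{1}k14 -k34 !(ac_lt K).
    rewrite (up_set_mid _ xm) (up_set_mid _ km) hA.
    by have -> : 2 * k x - 1 / 2 = h (2 * x - 1 / 2) by rewrite /k; field.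
  rewrite (kout _ xN) (up_set_ends _ xN) (up_set_ends _ xN).
  by rewrite (hA 0) (hA 1) h0 h1.
have [xm|xN] := boolP (1 / 4 < x < 3 / 4); last by rewrite kout.
have km : 1 / 4 < k x < 3 / 4 by rewrite -{1}k14 -k34 !(ac_lt K).
by split=> -[/andP[]|/andP[]]; move: xm km => /andP[? ?] /andP[? ?]; lra.
Qed.

(** If [h (1/4) < 1/4], then [h (1/4) <= 1/8] because 1/4 is not in [down_set]; but then the image
    of 3/16 is below 1/8, outside [down_set]. The other end is symmetric, and applying the lemma to
    the inverse as well gives equalities. *)
Lemma down_conj_quarter h hi : ac_auto h hi -> (forall x, down_set x <-> down_set (h x)) ->
  1 / 4 <= h (1 / 4) /\ h (3 / 4) <= 3 / 4.
Proof.
move=> H hD; split.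
  rewrite leNgt; apply/negP => lt.
  have N : ~ down_set (h (1 / 4)) by rewrite -hD => -[/andP[? ?]|/andP[? ?]]; lra.
  have le : h (1 / 4) <= 1 / 8.
    by rewrite leNgt; apply/negP => gt; apply: N; left; rewrite /= gt lt.
  have : down_set (h (3 / 16)) by apply: (hD _).1; left => /=; apply/andP; split; lra.
  have : h (3 / 16) < h (1 / 4) by rewrite (ac_lt H); lra.
  by move=> ? [/andP[? ?]|/andP[? ?]]; lra.
rewrite leNgt; apply/negP => lt.
have N : ~ down_set (h (3 / 4)) by rewrite -hD => -[/andP[? ?]|/andP[? ?]]; lra.
have le : 7 / 8 <= h (3 / 4).
  by rewrite leNgt; apply/negP => gt; apply: N; right; rewrite /= gt lt.
have : down_set (h (13 / 16)) by apply: (hD _).1; right => /=; apply/andP; split; lra.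
have : h (3 / 4) < h (13 / 16) by rewrite (ac_lt H); lra.
by move=> ? [/andP[? ?]|/andP[? ?]]; lra.
Qed.

Lemma up_set_conj_inv A1 A2 k ki : A1 `<=` [set x | 0 <= x <= 1] ->
  A2 `<=` [set x | 0 <= x <= 1] -> ac_auto k ki ->
  (forall x, up_set A1 x <-> up_set A2 (k x)) ->
  (forall x, down_set x <-> down_set (k x)) ->
  exists h hi, ac_auto h hi /\ forall x, A1 x <-> A2 (h x).
Proof.
move=> A1I A2I K kU kD; have Ki := ac_inv K.
have kDi x : down_set x <-> down_set (ki x) by rewrite (kD (ki x)) (acKi K).
have kUi x : up_set A2 x <-> up_set A1 (ki x) by rewrite (kU (ki x)) (acKi K).
have [a1 a2] := down_conj_quarter K kD; have [b1 b2] := down_conj_quarter Ki kDi.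
have k14 : k (1 / 4) = 1 / 4.
  by apply: le_anti; rewrite a1 andbT -(ac_le Ki) (acK K).
have k34 : k (3 / 4) = 3 / 4.
  by apply: le_anti; rewrite a2 /= -(ac_le Ki) (acK K).
(* The inverse rescaling, cut off outside []0, 1[] because [k] need not be the identity outside
   [[1/4, 3/4]]. *)
pose cj f x : R := if 0 < x < 1 then 2 * f (2^-1 * x + 1 / 4) + - (1 / 2) else x.
have range f fi x : ac_auto f fi -> f (1 / 4) = 1 / 4 -> f (3 / 4) = 3 / 4 ->
    0 < x < 1 -> 0 < 2 * f (2^-1 * x + 1 / 4) + - (1 / 2) < 1.
  move=> Hf f1 f2 /andP[x0 x1].
  have : f (1 / 4) < f (2^-1 * x + 1 / 4) by rewrite (ac_lt Hf); lra.
  have : f (2^-1 * x + 1 / 4) < f (3 / 4) by rewrite (ac_lt Hf); lra.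
  by rewrite f1 f2 => ? ?; apply/andP; split; lra.
have ki14 : ki (1 / 4) = 1 / 4 by rewrite -{1}k14 (acK K).
have ki34 : ki (3 / 4) = 3 / 4 by rewrite -{1}k34 (acK K).
have canc f fi : ac_auto f fi -> f (1 / 4) = 1 / 4 -> f (3 / 4) = 3 / 4 -> cancel (cj f) (cj fi).
  move=> Hf f1 f2 x; have [x01|/negPf xN] := boolP (0 < x < 1); last first.
    by rewrite /cj xN /= xN.
  rewrite /cj x01 (range _ _ _ Hf f1 f2 x01).
  have -> : 2^-1 * (2 * f (2^-1 * x + 1 / 4) + - (1 / 2)) + 1 / 4 = f (2^-1 * x + 1 / 4) by field.
  by rewrite (acK Hf); field.
have lus f : lusin f -> lusin (cj f).
  move=> lf; pose FF (b : bool) x := if b then 2 * f (2^-1 * x + 1 / 4) + - (1 / 2) else x.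
  apply: (@lusin_cover _ _ _ FF) => x; exists (0 < x < 1); rewrite /cj /FF; split=> //.
  case: (0 < x < 1); last exact: lusin_id.
  have l2 : lusin (fun x : R => 2 * x + - (1 / 2)) by exact: lusin_affine.
  have l3 : lusin (fun x : R => 2^-1 * x + 1 / 4) by apply: lusin_affine; rewrite invr_gt0.
  exact: lusin_comp l2 (lusin_comp lf l3).
have H : ac_auto (cj k) (cj ki).
  split.
  - exact: canc K _ _.
  - exact: canc Ki _ _.
  - move=> x y xy; rewrite /cj; case: ifPn => [/[dup] x01 /andP[x0 x1]|xN];
      case: ifPn => [/[dup] y01 /andP[y0 y1]|yN] //.
    + rewrite ltrD2r ltr_pM2l// (ac_lt K); lra.
    + have := range _ _ _ K k14 k34 x01; move: yN;
      rewrite negb_and -!leNgt => /orP[] ? /andP[? ?]; lra.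
    + have := range _ _ _ K k14 k34 y01; move: xN;
      rewrite negb_and -!leNgt => /orP[] ? /andP[? ?]; lra.
  - by move=> x /negPf xN; rewrite /cj xN.
  - exact/lus/(ac_lusin K).
  - exact/lus/(ac_lusin_inv K).
exists (cj k), (cj ki); split => // x.
have notnot (P Q : Prop) : (~ P <-> ~ Q) -> (P <-> Q).
  by move=> [a b]; split=> [p|q]; apply: contrapT => /[dup] ? ; [move/b|move/a].
have [x01|xN] := boolP (0 < x < 1).
  have xm : 1 / 4 < 2^-1 * x + 1 / 4 < 3 / 4.
    by move/andP: x01 => [? ?]; apply/andP; split; lra.
  have km : 1 / 4 < k (2^-1 * x + 1 / 4) < 3 / 4 by rewrite -{1}k14 -k34 !(ac_lt K).
  apply: notnot; have := kU (2^-1 * x + 1 / 4).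
  rewrite (up_set_mid _ xm) (up_set_mid _ km) /cj x01.
  by have -> : 2 * (2^-1 * x + 1 / 4) - 1 / 2 = x by field.
rewrite /cj (negPf xN).
(* On []0, 1/4[], which [f] preserves, [up_set A] is empty or []0, 1/8[] according to whether [A]
   contains 0; the midpoint 1/16 is the test point. *)
have low A A' f fi : ac_auto f fi -> f (1 / 4) = 1 / 4 ->
    (forall x, up_set A x <-> up_set A' (f x)) -> ~ A 0 -> ~ A' 0.
  move=> Hf f1 fU A0.
  have l : 0 < (1 / 16 : R) < 1 / 4 by apply/andP; split; lra.
  have fl : 0 < f (1 / 16) < 1 / 4.
    have f0 : f 0 = 0 by apply: (ac_out Hf); rewrite ltxx.
    have : f 0 < f (1 / 16) < f (1 / 4) by rewrite !(ac_lt Hf).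
    by rewrite f0 f1.
  have : up_set A (1 / 16) by apply/up_set_low => //; split => //; lra.
  by rewrite fU (up_set_low _ fl) => -[].
have high A A' f fi : ac_auto f fi -> f (3 / 4) = 3 / 4 ->
    (forall x, up_set A x <-> up_set A' (f x)) -> ~ A 1 -> ~ A' 1.
  move=> Hf f1 fU A0.
  have l : 3 / 4 < (15 / 16 : R) < 1 by apply/andP; split; lra.
  have fl : 3 / 4 < f (15 / 16) < 1.
    have f0 : f 1 = 1 by apply: (ac_out Hf); rewrite ltxx andbF.
    have : f (3 / 4) < f (15 / 16) < f 1 by rewrite !(ac_lt Hf).
    by rewrite f0 f1.
  have : up_set A (15 / 16) by apply/up_set_high => //; split => //; lra.
  by rewrite fU (up_set_high _ fl) => -[].
have [->|x0] := eqVneq x 0.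
  by apply: notnot; split; [exact: low K _ _|exact: low Ki _ _].
have [->|x1] := eqVneq x 1.
  by apply: notnot; split; [exact: high K _ _|exact: high Ki _ _].
have xout : ~ (0 <= x <= 1).
  move=> /andP[? ?]; move/negP: xN; apply.
  by rewrite !lt_neqAle eq_sym x0 x1 !andTb; apply/andP; split.
by split=> [/A1I|/A2I].
Qed.

End sets_to_conjugacy.

(** * The code of a closed set and its measurability *)

Section sets_reduction.
Variable R : realType.
Local Notation CS := (closed_subsets (I01 R)).

Definition set_code (F : CS) := gap_code (up_set (val @` (F : set _))) (@down_set R).

Lemma closed_val_image (F : CS) : closed (val @` (F : set _) : set R).
Proof. by apply: compact_closed; [exact: Rhausdorff|apply: compact_val; exact: closed_setP]. Qed.

Lemma val_image_unit (F : CS) : val @` (F : set _) `<=` [set x : R | 0 <= x <= 1].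
Proof. by move=> _ [t _ <-]; exact: I01P. Qed.

Lemma set_code_sign (F : CS) (f : R -> R) x :
  f = (fun x => x + disp (coef R (set_code F)) x) ->
  (x < f x <-> up_set (val @` (F : set _)) x) /\ (f x < x <-> down_set x).
Proof.
move=> ->; set A := val @` _.
have [p n z] := gap_code_sign x (open_up_set (@closed_val_image F)) (@open_down_set R)
  (up_down_disjoint A) (@up_set_unit R A) (@down_set_unit R).
rewrite ltrDl gtrDl.
have disj : up_set A x -> down_set x -> False.
  by move=> u d; suff : set0 x by []; rewrite -(up_down_disjoint A).
split; split => //.
- move=> lt; apply: contrapT => nu; have [d|nd] := pselect (down_set x).
    by have := lt_trans lt (n d); rewrite ltxx.
  by move: lt; rewrite /set_code z// ltxx.
- move=> lt; apply: contrapT => nd; have [u|nu] := pselect (up_set A x).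
    by have := lt_trans lt (p u); rewrite ltxx.
  by move: lt; rewrite /set_code z// ltxx.
Qed.

Lemma E_H_coded (Phi : (nat -> bool * bool) -> AC01 R) :
  (forall s, ext (Phi s) = (fun x => x + disp (coef R s) x)) ->
  forall F1 F2 : CS, E_H F1 F2 <-> E_C (Phi (set_code F1)) (Phi (set_code F2)).
Proof.
move=> PhiE F1 F2; rewrite E_HP E_CP.
have S F x := set_code_sign x (PhiE (set_code F)).
split=> -[h [hi [H hF]]].
  have [k [ki [K kU kD]]] := up_set_conj H hF.
  apply: (conj_ac_auto (ext_auto _) (ext_auto _) K) => x.
  - have [s1 _] := S F1 x; have [s2 _] := S F2 (k x).
    by apply/idP/idP => [/s1 u|/s2 u]; [exact/s2/(kU x).1|exact/s1/(kU x).2].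
  - have [_ s1] := S F1 x; have [_ s2] := S F2 (k x).
    by apply/idP/idP => [/s1 u|/s2 u]; [exact/s2/(kD x).1|exact/s1/(kD x).2].
apply: (up_set_conj_inv (@val_image_unit F1) (@val_image_unit F2) H) => x.
  have [s1 _] := S F1 x; have [s2 _] := S F2 (h x).
  by rewrite -s1 -s2 -hF (ac_lt H).
have [_ s1] := S F1 x; have [_ s2] := S F2 (h x).
by rewrite -s1 -s2 -hF (ac_lt H).
Qed.

Lemma measurable_Prop d (T : measurableType d) (C : Prop) : measurable [set x : T | C].
Proof.
have [c|c] := pselect C.
  by rewrite (_ : [set _ | _] = setT)//; apply/seteqP; split.
by rewrite (_ : [set _ | _] = set0)//; apply/seteqP; split.
Qed.

Lemma open_vietoris_subbase (V : set CS) : vietoris_subbase V -> open V.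
Proof.
move=> sV; exists [set V]; last by rewrite bigcup_set1.
by move=> _ ->; apply: finI_from1.
Qed.

Lemma open_hit (U : set (I01 R)) : open U -> open [set F : CS | (F : set _) `&` U !=set0].
Proof. by move=> oU; apply: open_vietoris_subbase; right; exists U. Qed.

Lemma open_inside (U : set (I01 R)) : open U -> open [set F : CS | (F : set _) `<=` U].
Proof. by move=> oU; apply: open_vietoris_subbase; left; exists U. Qed.

Lemma open_preim (h : R -> R) (V : set R) : continuous h -> open V ->
  open [set t : I01 R | V (h (val t))].
Proof.
move=> hc oV; exists (h @^-1` V); last by [].
by apply: open_comp => // x _; exact: hc.
Qed.

Lemma open_rat_gap n : open (@rat_gap R n).
Proof. exact: open_itv_set. Qed.

(** The interval [J] lies in the set moved up iff it avoids the rest of the line (a condition free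
    of [F]), [F] misses the rescaled [J] in the middle part, and [F] omits 0 or 1 whenever [J] meets
    the corresponding outer interval. Omitting 0 or 1 is inclusion in an open set, a subbasic
    Vietoris condition. *)
Lemma measurable_up_code n :
  (@measurable _ (borel CS)) [set F | (set_code F n).1].
Proof.
pose J := @rat_gap R n.
pose mid : set R := [set x | 1 / 4 < x < 3 / 4].
pose low : set R := [set x | 0 < x < 1 / 8].
pose high : set R := [set x | 7 / 8 < x < 1].
pose hits : set CS := [set F | (F : set _) `&` [set t | (J `&` mid) (2^-1 * val t + 1 / 4)] !=set0].
pose no0 : set CS := [set F | (F : set _) `<=` [set t | [set x : R | 0 < x < 2] (val t)]].
pose no1 : set CS := [set F | (F : set _) `<=` [set t | [set x : R | -1 < x < 1] (val t)]].
have id_cont : continuous (@id R) by move=> x; exact: cvg_id.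
have aff_cont : continuous (fun x : R => 2^-1 * x + 1 / 4).
  move=> x; apply: cvgD; last exact: cvg_cst.
  by apply: cvgM; [exact: cvg_cst|exact: cvg_id].
have mhits : (@measurable _ (borel CS)) hits.
  apply: measurable_open; apply: open_hit.
  apply: (open_preim (h := fun x => 2^-1 * x + 1 / 4) (V := J `&` mid)) => //.
  by apply: openI; [exact: open_rat_gap|exact: open_itv_set].
have mno0 : (@measurable _ (borel CS)) no0.
  apply: measurable_open; apply: open_inside.
  by apply: (open_preim (h := id)) => //; exact: open_itv_set.
have mno1 : (@measurable _ (borel CS)) no1.
  apply: measurable_open; apply: open_inside.
  by apply: (open_preim (h := id)) => //; exact: open_itv_set.
have no0E (F : CS) : no0 F <-> ~ (val @` (F : set _)) (0 : R).
  split=> [H [t /H /= /andP[t0 _] tE]|H t Ft /=]; first by rewrite tE ltxx in t0.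
  have /andP[t0 t1] := I01P t; rewrite (le_lt_trans t1) ?ltr1n// andbT lt_neqAle t0 andbT.
  by apply/eqP => tE; apply: H; exists t.
have no1E (F : CS) : no1 F <-> ~ (val @` (F : set _)) (1 : R).
  split=> [H [t /H /= /andP[_ t1] tE]|H t Ft /=]; first by rewrite tE ltxx in t1.
  have /andP[t0 t1] := I01P t; rewrite (lt_le_trans _ t0) ?ltrN10//= lt_neqAle t1 andbT.
  by apply/eqP => tE; apply: H; exists t.
have -> : [set F | (set_code F n).1] =
    [set F : CS | J `<=` mid `|` (low `|` high)] `&` ~` hits `&`
    (if `[< J `&` low !=set0 >] then no0 else setT) `&`
    (if `[< J `&` high !=set0 >] then no1 else setT).
  apply/seteqP; split => F /=.
    move=> /asboolP JU; have mem x : J x -> up_set (val @` (F : set _)) x by exact: JU.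
    split; first split; first split.
    - by move=> x /mem [[? _]|[[? _]|[? _]]]; [left|right; left|right; right].
    - move=> [t [Ft [/mem Jt mt]]]; have := (up_set_mid _ mt).1 Jt; apply; exists t => //.
      by field.
    - case: asboolP => // -[x [/mem Jx /andP[x0 x8]]]; apply/no0E.
      have xl : 0 < x < 1 / 4 by rewrite x0; lra.
      by have [] := (up_set_low _ xl).1 Jx.
    - case: asboolP => // -[x [/mem Jx /andP[x8 x1]]]; apply/no1E.
      have xl : 3 / 4 < x < 1 by rewrite x1 andbT; lra.
      by have [] := (up_set_high _ xl).1 Jx.
  move=> [[[JD nh] h0] h1]; apply/asboolP => x Jx.
  have [mx|[lx|hx]] := JD _ Jx.
  - apply/(up_set_mid _ mx) => -[t Ft tE]; apply: nh; exists t; split => //=.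
    by rewrite tE (_ : 2^-1 * (2 * x - 1 / 2) + 1 / 4 = x)//; field.
  - right; left; split => //; apply/no0E; move: h0; case: asboolP => // H _.
    by exfalso; apply: H; exists x.
  - right; right; split => //; apply/no1E; move: h1; case: asboolP => // H _.
    by exfalso; apply: H; exists x.
have mT : (@measurable _ (borel CS)) setT by exact: measurableT.
apply: measurableI; last by case: asboolP.
apply: measurableI; last by case: asboolP.
by apply: measurableI; [exact: (@measurable_Prop _ (borel CS))|exact: measurableC].
Qed.

Lemma E_H_reducible_E_C : borel_reducible (@E_H R) (@E_C R).
Proof.
have [Phi PhiE] := exists_coded R.
exists (fun F => Phi (set_code F)); last exact: E_H_coded.
apply: measurable_coded => // n; first exact: measurable_up_code.
(* The set moved down is the same for every [F], so this part of the code is constant. *)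
exact: (@measurable_Prop _ (borel CS) (is_true `[< @rat_gap R n `<=` @down_set R >])).
Qed.

End sets_reduction.

Theorem corollary3p32 (R : realType) :
  borel_bireducible (@E_C R) (@E_H R).
Proof. by split; [exact: E_C_reducible_E_H|exact: E_H_reducible_E_C]. Qed.
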